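(* For every $d<\infty$ there exists a constant $C_d<\infty$, depending only on $d$, such that the following holds. Let $G=(V,E)$ be a connected, possibly infinite, simple graph with non-negative Ollivier--Ricci curvature and with all vertex degrees bounded by $d$. Let $(X_n)_{n\ge0}$ be the discrete-time lazy random walk on $G$. Then for every $x\in V$ and every integer $n\ge e^e$, \[ \mathbb E_x\,\mathrm{dist}(x,X_n)^2\le n\exp\left[C_d\sqrt{\log (n)\,\log\log (n)}\right]. \]
   Context: $G=(V,E)$ is a connected, locally finite, simple graph with at least one edge. Its random walk kernel is $P(x,y)=\mathbf 1_{\{x\sim y\}}/\deg(x)$, and $\widehat P=\frac12(I+P)$ is its lazy version. $\mathrm{dist}$ is the graph distance. The discrete-time lazy random walk $(X_n)_{n\ge0}$ is the Markov chain on $V$ with transition kernel $\widehat P$; $\mathbb E_x$ is expectation for the walk started at $X_0=x$. For probability measures $\mu,\nu$ on $V$, $W_1(\mu,\nu)=\inf_\pi\sum_{u,v\in V}\mathrm{dist}(u,v)\pi(u,v)$, the infimum being over all couplings $\pi$ of $\mu$ and $\nu$. $G$ has non-negative Ollivier--Ricci curvature if $W_1(\widehat P(x,\cdot),\widehat P(y,\cdot))\le 1$ whenever $x\sim y$. *)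

(* Defs.v *)
From HB Require Import structures.
From mathcomp Require Import all_boot all_order all_algebra finmap.
From mathcomp Require Import all_classical all_reals all_analysis.

Set Implicit Arguments.
Unset Strict Implicit.
Unset Printing Implicit Defensive.
Import Order.TTheory GRing.Theory Num.Theory.
Local Open Scope classical_set_scope.
Local Open Scope ring_scope.

Section Graph.
Variables (R : realType) (V : choiceType) (adj : rel V).

Definition nbhd (x : V) : set V := [set y | adj x y].

Definition locally_finite : Prop := forall x, finite_set (nbhd x).

(* Meaningful when [nbhd x] is finite: [fset_set] sends infinite sets to the
   empty finite set. *)
Definition deg (x : V) : nat := #|` fset_set (nbhd x)|.

Definition walk (x y : V) (n : nat) : Prop :=
  exists p : seq V, [/\ path adj x p, last x p = y & size p = n].

Definition graph_connected : Prop := forall x y, exists n, walk x y n.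

Lemma walk_asbool (x y : V) :
  (exists n, walk x y n) -> exists n, (fun n => `[< walk x y n >]) n.
Proof. by case=> n w; exists n; apply/asboolP. Qed.

(* The value 0 for vertices in different components is a dummy. *)
Definition gdist (x y : V) : nat :=
  if pselect (exists n, walk x y n) is left h then ex_minn (walk_asbool h)
  else 0%N.

Definition rw_kernel (x y : V) : R := (adj x y)%:R / (deg x)%:R.

Definition lazy_kernel (x y : V) : R := ((x == y)%:R + rw_kernel x y) / 2.

(* Probability measures on V, which is countable when the graph is connected
   and locally finite, are given by their mass functions. *)
Definition coupling (mu nu : V -> R) (pi : V * V -> R) : Prop :=
  [/\ forall uv, 0 <= pi uv,
      forall u, \esum_(v in [set: V]) (pi (u, v))%:E = (mu u)%:E
    & forall v, \esum_(u in [set: V]) (pi (u, v))%:E = (nu v)%:E].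

Definition W1 (mu nu : V -> R) : \bar R :=
  ereal_inf [set (\esum_(uv in [set: V * V])
                     ((gdist uv.1 uv.2)%:R * pi uv)%:E)
            | pi in coupling mu nu].

Definition nonneg_Ollivier_Ricci : Prop :=
  forall x y, adj x y -> (W1 (lazy_kernel x) (lazy_kernel y) <= 1)%E.

End Graph.

(* [X] is a Markov chain on the discrete space [V] with transition kernel [K]
   started at [x]. The last clause is the Markov property
   P(X_(n+1) = v | X_0 = s_0, ..., X_n = s_n) = K(s_n, v), with the
   conditional probability multiplied out. *)
Definition markov_chain (R : realType) (V : choiceType) (K : V -> V -> R)
    (x : V) (d : measure_display) (Omega : measurableType d)
    (P : probability Omega R) (X : nat -> Omega -> V) : Prop :=
  [/\ forall n (A : set V), measurable (X n @^-1` A),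
      P [set w | X 0%N w = x] = 1%E
    & forall n (s : nat -> V),
        P [set w | forall i, (i <= n.+1)%N -> X i w = s i] =
        (P [set w | forall i, (i <= n)%N -> X i w = s i] *
          (K (s n) (s n.+1))%:E)%E].

(* Main.v *)
Require Import Defs.
From HB Require Import structures.
From mathcomp Require Import all_boot all_order all_algebra.
From mathcomp Require Import all_classical all_reals all_analysis.
From mathcomp Require Import finmap measurable_realfun zify ring lra.

Set Implicit Arguments.
Unset Strict Implicit.
Unset Printing Implicit Defensive.
Import Order.TTheory GRing.Theory Num.Theory.
Local Open Scope classical_set_scope.
Local Open Scope ring_scope.

(** Write [P] for the lazy kernel. The walk from [x] at time [n] is at distance
    [r] from [x] with probability controlled by the heat kernel bound
    [p_n(x, z) <= sqrt D * exp (- r ^ 2 / (8 n))] of Varopoulos and Carne. Hence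
    the second moment of the displacement is at most [8 n] times the entropy [H_n]
    of the walk, up to a constant ([second_moment_le]), and it suffices to show
    that the entropy grows more slowly than any power of [n].

    Curvature gives a dimension-free Harnack inequality ([log_harnack]): the
    relative entropy of the law at time [m] from [y] with respect to the law from
    [x] at about the same time is [O (d(x, y) ^ 2 / m + log m)]. For the proof, let
    the walker from [x] chase the walker from [y]: at each step it follows the
    optimal coupling, except that with a small probability [e] it makes a step
    towards the other one. Nonnegative curvature says that under the optimal
    coupling the mean distance does not increase, so the chase makes it decrease by
    [e / 2] per step; the price, in relative entropy, is [O (e ^ 2)] per step, as the
    degrees are bounded. Taking [e] of the order of the distance divided by the
    remaining time gives the bound. Only the mean distance is controlled, and the
    logarithm is the price of its fluctuations, which have bounded increments.

    The entropy gained from time [m] to time [m + T] is the information that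
    the position at time [m + T] carries about the position at time [T]. By the
    Harnack inequality it is [O (E d(x, X_T) ^ 2 / m + log m)], and by the heat
    kernel bound [E d(x, X_T) ^ 2 = O (T (H_T + 1))]. Adding [N / T] blocks of
    length [T] therefore gives [H_N = O (log N * (H_T + N / T))]
    ([entropy_growth]). Starting from [H_m = O (m)] and multiplying the time [k]
    times by [m], the entropy at time [n = m ^ (k + 1)] is at most
    [m * (C * log n) ^ k] ([entropy_iter]), and [k] of order
    [sqrt (log n / log log n)] gives the theorem. *)

(** * Graph distance and the lazy kernel *)

(** The standing assumptions, bundled so that each lemma takes one hypothesis. *)
Record curved_graph (R : realType) (V : choiceType) (adj : rel V) (D : nat) :
    Prop := CurvedGraph {
  cg_sym : symmetric adj;
  cg_irr : irreflexive adj;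
  cg_edge : exists x y, adj x y;
  cg_conn : graph_connected adj;
  cg_fin : locally_finite adj;
  cg_deg : forall x, (deg adj x <= D)%N;
  cg_curv : nonneg_Ollivier_Ricci R adj }.

Section GraphMetric.
Variables (R : realType) (V : choiceType) (adj : rel V) (D : nat).
Hypothesis G : curved_graph R adj D.
Implicit Types (x y z : V) (n : nat).
Local Notation d := (gdist adj).

Lemma walk0 x : walk adj x x 0.
Proof. by exists [::]. Qed.

Lemma walk_cons x y z n : adj x y -> walk adj y z n -> walk adj x z n.+1.
Proof. by move=> xy [p [pp <- <-]]; exists (y :: p); rewrite /= xy pp. Qed.

Lemma walk_inv x z n :
  walk adj x z n.+1 -> exists2 y, adj x y & walk adj y z n.
Proof.
case=> -[|y p] [] //= /andP[xy pp] <- [<-].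
by exists y => //; exists p.
Qed.

Lemma walk_cat x y z m n :
  walk adj x y m -> walk adj y z n -> walk adj x z (m + n).
Proof.
case=> p [pp <- <-] [q [qp <- <-]]; exists (p ++ q).
by rewrite cat_path pp qp last_cat size_cat.
Qed.

Lemma walk_sym x y n : walk adj x y n -> walk adj y x n.
Proof.
elim: n x => [|n IH] x.
  by case=> -[|? ?] [] //= _ -> _; exact: walk0.
case/walk_inv => z xz /IH w; rewrite -addn1; apply: walk_cat w _.
by apply: walk_cons (walk0 x); rewrite (cg_sym G).
Qed.

Lemma gdist_walk x y : walk adj x y (d x y).
Proof.
rewrite /gdist; case: pselect => [h|]; last by case; apply: (cg_conn G).
by case: ex_minnP => n /asboolP.
Qed.

Lemma gdist_min x y n : walk adj x y n -> (d x y <= n)%N.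
Proof.
move=> w; rewrite /gdist; case: pselect => // h.
by case: ex_minnP => m _; apply; apply/asboolP.
Qed.

Lemma gdistxx x : d x x = 0%N.
Proof. by apply/eqP; rewrite -leqn0; apply: gdist_min (walk0 x). Qed.

Lemma gdist_eq0 x y : d x y = 0%N -> x = y.
Proof. by move=> e; have := gdist_walk x y; rewrite e => -[[|? ?] []]. Qed.

Lemma gdistC x y : d x y = d y x.
Proof.
by apply/eqP; rewrite eqn_leq !gdist_min //; apply/walk_sym/gdist_walk.
Qed.

Lemma gdist_triangle x y z : (d x z <= d x y + d y z)%N.
Proof. by apply/gdist_min/walk_cat; apply: gdist_walk. Qed.

Lemma gdist_adj x y : adj x y -> (d x y <= 1)%N.
Proof. by move=> xy; apply/gdist_min/(walk_cons xy)/walk0. Qed.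

Lemma gdist_step x y : x <> y -> exists2 x1, adj x x1 & d x y = (d x1 y).+1.
Proof.
move=> xy; have := gdist_walk x y.
case E : (d x y) => [|n]; first by move/gdist_eq0 : E.
case/walk_inv => x1 xx1 w; exists x1 => //; congr S.
apply/eqP; rewrite eqn_leq (gdist_min w) andbT -ltnS -E.
by rewrite (leq_trans (gdist_triangle x x1 y))// -add1n leq_add2r gdist_adj.
Qed.

(** The support of one lazy step; listing the point itself first matches the
    two terms of the lazy kernel. *)
Definition nb x : seq V := x :: fset_set (nbhd adj x).

Lemma mem_nb x y : (y \in nb x) = (y == x) || adj x y.
Proof.
rewrite inE in_fset_set; last exact: (cg_fin G).
by congr (_ || _); apply/idP/idP => [/set_mem|/mem_set].
Qed.

Lemma nb_refl x : x \in nb x. Proof. by rewrite inE eqxx. Qed.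

Lemma adj_nb x y : adj x y -> y \in nb x.
Proof. by move=> xy; rewrite mem_nb xy orbT. Qed.

Lemma nb_uniq x : uniq (nb x).
Proof.
rewrite /= fset_uniq andbT in_fset_set; last exact: (cg_fin G).
by apply/negP => /set_mem; rewrite /nbhd /= (cg_irr G).
Qed.

Lemma nbP x y : reflect (d x y <= 1)%N (y \in nb x).
Proof.
rewrite mem_nb; apply: (iffP orP) => [[/eqP->|/gdist_adj//]|].
  by rewrite gdistxx.
case: (eqVneq y x) => [|yx dxy]; [by left|right].
have [|x1 xx1] := @gdist_step x y; first by move=> e; rewrite e eqxx in yx.
by move=> e; move: dxy; rewrite e ltnS leqn0 => /eqP/gdist_eq0 <-.
Qed.

Lemma nb_sym x y : (y \in nb x) = (x \in nb y).
Proof. by rewrite !mem_nb eq_sym (cg_sym G). Qed.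

Lemma gdist_nb2 x y u v :
  u \in nb x -> v \in nb y -> (d u v <= d x y + 2)%N.
Proof.
move=> /nbP ux /nbP vy.
apply: leq_trans (gdist_triangle u x v) _; rewrite gdistC.
have := gdist_triangle x y v.
move: (d x u) (d x v) (d x y) (d y v) ux vy => a b c e; lia.
Qed.

Lemma deg_gt0 x : (0 < deg adj x)%N.
Proof.
suff [y xy] : exists y, adj x y.
  rewrite /deg cardfs_gt0; apply/fset0Pn; exists y.
  by rewrite in_fset_set; [exact: mem_set|exact: (cg_fin G)].
have [a [b ab]] := cg_edge G.
have [xa|xa] := eqVneq x a; first by exists b; rewrite xa.
have [y xy _] := @gdist_step x a (fun e => negP xa (introT eqP e)).
by exists y.
Qed.

Lemma maxdeg_gt0 : (0 < D)%N.
Proof.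
have [a [b ab]] := cg_edge G.
exact: leq_trans (deg_gt0 a) (cg_deg G a).
Qed.

Local Notation K := (lazy_kernel R adj).

Lemma kernel_ge0 x y : 0 <= K x y.
Proof.
apply: mulr_ge0; last by rewrite invr_ge0.
by apply: addr_ge0 => //; apply: mulr_ge0; rewrite ?invr_ge0.
Qed.

Lemma kernel_out x y : y \notin nb x -> K x y = 0.
Proof.
rewrite mem_nb negb_or eq_sym => /andP[/negPf xy /negPf xy'].
by rewrite /lazy_kernel /rw_kernel xy xy' !mul0r addr0 mul0r.
Qed.

Lemma kernel_lb x y : y \in nb x -> ((2 * D)%:R^-1 <= K x y).
Proof.
have D0 : (0 : R) < D%:R by rewrite ltr0n maxdeg_gt0.
have d0 : (0 : R) < (deg adj x)%:R by rewrite ltr0n deg_gt0.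
rewrite natrM invfM mulrC mem_nb /lazy_kernel => xy.
rewrite ler_pM2r ?invr_gt0//.
rewrite /rw_kernel; case/orP : xy => [/eqP ->|->].
  rewrite eqxx -[leLHS]addr0 lerD//; by rewrite invf_le1// ler1n maxdeg_gt0.
rewrite -[leLHS]add0r lerD// mul1r lef_pV2 ?posrE// ler_nat; exact: (cg_deg G).
Qed.

Lemma kernel_gt0 x y : y \in nb x -> 0 < K x y.
Proof.
move/kernel_lb; apply: lt_le_trans.
by rewrite invr_gt0 ltr0n muln_gt0 maxdeg_gt0.
Qed.

Lemma kernelxx x : K x x = 2^-1.
Proof.
by rewrite /lazy_kernel /rw_kernel eqxx (cg_irr G) mul0r addr0 mul1r.
Qed.

Lemma kernel_adj x y : adj x y -> K x y = ((deg adj x)%:R^-1) / 2.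
Proof.
move=> xy; rewrite /lazy_kernel /rw_kernel xy mul1r.
by case: eqVneq xy => [->|]; rewrite ?(cg_irr G)// add0r.
Qed.

Lemma mem_nbhs x y : (y \in fset_set (nbhd adj x)) = adj x y.
Proof.
rewrite in_fset_set; last exact: (cg_fin G).
by apply/idP/idP => [/set_mem|/mem_set].
Qed.

Lemma sum_nb x (f : V -> R) :
  \sum_(y <- nb x) K x y * f y = f x / 2 +
    ((deg adj x)%:R^-1) / 2 * \sum_(y <- fset_set (nbhd adj x)) f y.
Proof.
rewrite big_cons kernelxx mulrC mulr_sumr; congr (_ + _).
by apply: eq_big_seq => y; rewrite mem_nbhs => /kernel_adj ->.
Qed.

Lemma sum_kernel x : \sum_(y <- nb x) K x y = 1.
Proof.
have := sum_nb x (fun=> 1); under eq_bigr do rewrite mulr1.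
move=> ->; rewrite big_const_seq count_predT iter_addr_0.
rewrite -/(deg adj x) -mulrA -mulr_natl mulr1 mulrCA mulVf ?mulr1; first by lra.
by rewrite pnatr_eq0 -lt0n deg_gt0.
Qed.

Lemma kernel_rev x y : (deg adj x)%:R * K x y = (deg adj y)%:R * K y x.
Proof.
have [->//|xy] := eqVneq x y.
rewrite /lazy_kernel /rw_kernel [y == x]eq_sym (negPf xy) !add0r (cg_sym G).
have n0 z : (deg adj z)%:R != 0 :> R by rewrite pnatr_eq0 -lt0n deg_gt0.
by rewrite !mulrA ![_ * _%:R / _]mulrAC !mulfV// mul1r.
Qed.

End GraphMetric.

(** * The averaging operator and the heat kernel *)

Section AveragingOperator.
Variables (R : realType) (V : choiceType) (adj : rel V) (D : nat).
Hypothesis G : curved_graph R adj D.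
Implicit Types (x y z : V) (n m : nat) (f g : V -> R).
Local Notation d := (gdist adj).
Local Notation K := (lazy_kernel R adj).

Definition avg f x : R := \sum_(y <- nb adj x) K x y * f y.

Definition dirac_at z : V -> R := fun y => (y == z)%:R.

(** The n-step transition probability. *)
Definition heat n x z : R := iter n avg (dirac_at z) x.

Definition gball x n : seq V :=
  iter n (fun s => undup (flatten [seq nb adj y | y <- s])) [:: x].

Lemma gball_uniq x n : uniq (gball x n).
Proof. by case: n => //= n; exact: undup_uniq. Qed.

Lemma mem_gball x n z : (z \in gball x n) = (d x z <= n)%N.
Proof.
elim: n z => [|n IH] z.
  rewrite inE leqn0; apply/eqP/eqP => [->|/(gdist_eq0 G)->//].
  exact: gdistxx.
rewrite /gball iterS -/(gball x n) mem_undup; apply/flatten_mapP/idP.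
  case=> y; rewrite IH => xy /(nbP G) yz.
  by apply: leq_trans (gdist_triangle G x y z) _; rewrite -addn1 leq_add.
rewrite leq_eqVlt ltnS => /orP[/eqP xz|xz]; last first.
  by exists z; rewrite ?IH ?nb_refl.
have zx : z <> x by move=> e; move: xz; rewrite e gdistxx.
have [y zy e] := gdist_step G zx.
exists y; last by rewrite (nb_sym G) (adj_nb G).
by rewrite IH (gdistC G) -ltnS -e (gdistC G) xz.
Qed.

Lemma iter_avgD m n f x :
  iter (m + n) avg f x = iter m avg (iter n avg f) x.
Proof. by rewrite iterD. Qed.

Lemma avg_le f g x : (forall y, y \in nb adj x -> f y <= g y) ->
  avg f x <= avg g x.
Proof.
move=> fg; rewrite /avg big_seq [leRHS]big_seq; apply: ler_sum => y yx.
by rewrite ler_wpM2l ?(kernel_ge0 R adj)// fg.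
Qed.

Lemma iter_avg_le n f g x : (forall z, (d x z <= n)%N -> f z <= g z) ->
  iter n avg f x <= iter n avg g x.
Proof.
elim: n x => [|n IH] x fg /=; first by apply: fg; rewrite gdistxx.
apply: avg_le => y /(nbP G) xy; apply: IH => z yz; apply: fg.
by apply: leq_trans (gdist_triangle G x y z) _; rewrite -addn1 addnC leq_add.
Qed.

Lemma iter_avg_local n f g x : (forall z, (d x z <= n)%N -> f z = g z) ->
  iter n avg f x = iter n avg g x.
Proof.
move=> fg; apply/eqP; rewrite eq_le.
by rewrite !iter_avg_le// => z /fg ->.
Qed.

Lemma iter_avg_ext n f g x : f =1 g -> iter n avg f x = iter n avg g x.
Proof. by move=> fg; apply: iter_avg_local. Qed.

Lemma avgD f g x : avg (fun y => f y + g y) x = avg f x + avg g x.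
Proof. by rewrite -big_split; apply: eq_bigr => y _; rewrite mulrDr. Qed.

Lemma avgZ a f x : avg (fun y => a * f y) x = a * avg f x.
Proof. by rewrite mulr_sumr; apply: eq_bigr => y _; rewrite mulrCA. Qed.

Lemma avg_cst a x : avg (fun=> a) x = a.
Proof. by rewrite /avg -mulr_suml (sum_kernel G) mul1r. Qed.

Lemma iter_avgDl n f g x :
  iter n avg (fun y => f y + g y) x = iter n avg f x + iter n avg g x.
Proof.
elim: n x => [//|n IH] x /=; rewrite -avgD.
by apply: eq_bigr => y _; rewrite IH.
Qed.

Lemma iter_avgZ n a f x :
  iter n avg (fun y => a * f y) x = a * iter n avg f x.
Proof.
elim: n x => [//|n IH] x /=; rewrite -avgZ.
by apply: eq_bigr => y _; rewrite IH.
Qed.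

Lemma iter_avg_cst n a x : iter n avg (fun=> a) x = a.
Proof.
elim: n x => [//|n IH] x /=; rewrite -[RHS](avg_cst a x).
by apply: eq_bigr => y _; rewrite IH.
Qed.

Lemma iter_avg_sum n (I : Type) (s : seq I) (F : I -> V -> R) x :
  iter n avg (fun y => \sum_(i <- s) F i y) x =
  \sum_(i <- s) iter n avg (F i) x.
Proof.
elim: s => [|i s IH].
  rewrite big_nil -[RHS](iter_avg_cst n 0 x); apply: iter_avg_ext => y.
  by rewrite big_nil.
rewrite big_cons -IH -iter_avgDl; apply: iter_avg_ext => y.
by rewrite big_cons.
Qed.

Lemma iter_avg_ge0 n f x : (forall z, 0 <= f z) -> 0 <= iter n avg f x.
Proof.
by move=> f0; rewrite -(iter_avg_cst n 0 x); apply: iter_avg_le.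
Qed.

Lemma sum_dirac (s : seq V) (f : V -> R) z : uniq s -> z \in s ->
  \sum_(y <- s) f y * dirac_at y z = f z.
Proof.
move=> us zs; rewrite (bigD1_seq z)//= /dirac_at eqxx mulr1.
by rewrite big1 ?addr0// => y /negPf; rewrite eq_sym => ->; rewrite mulr0.
Qed.

(** Since [V] may be infinite, expectations are expanded over any finite
    duplicate-free list that contains the ball reached in [n] steps. *)
Lemma iter_avg_heat n f x (s : seq V) : uniq s ->
    (forall z, (d x z <= n)%N -> z \in s) ->
  iter n avg f x = \sum_(z <- s) f z * heat n x z.
Proof.
move=> us xs.
rewrite (@iter_avg_local _ _ (fun y => \sum_(z <- s) f z * dirac_at z y)).
  by rewrite iter_avg_sum; apply: eq_bigr => z _; rewrite iter_avgZ.
by move=> z /xs zs; rewrite sum_dirac.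
Qed.

Lemma heat_ge0 n x z : 0 <= heat n x z.
Proof. by apply: iter_avg_ge0 => y; rewrite /dirac_at. Qed.

Lemma heat_out n x z : (n < d x z)%N -> heat n x z = 0.
Proof.
move=> nz; rewrite -(iter_avg_cst n 0 x); apply: iter_avg_local => y.
by rewrite /dirac_at; case: eqVneq => // ->; rewrite leqNgt nz.
Qed.

Lemma sum_heat n x (s : seq V) : uniq s ->
  (forall z, (d x z <= n)%N -> z \in s) -> \sum_(z <- s) heat n x z = 1.
Proof.
move=> us xs; rewrite -[RHS](iter_avg_cst n 1 x) (@iter_avg_heat n (fun=> 1) x s)//.
by apply: eq_bigr => z _; rewrite mul1r.
Qed.

(** Laziness lets the walk wait, so any point within distance [n] can be reached
    in exactly [n] steps, and no step has probability below [1 / (2 D)]. *)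
Lemma iter_avg_lb n f x y : (forall z, 0 <= f z) -> (d x y <= n)%N ->
  (2 * D)%:R^-1 ^+ n * f y <= iter n avg f x.
Proof.
move=> f0; elim: n x => [|n IH] x.
  by rewrite leqn0 => /eqP/(gdist_eq0 G) ->; rewrite expr0 mul1r.
move=> xy.
have [x1 xx1 x1y] : exists2 x1, x1 \in nb adj x & (d x1 y <= n)%N.
  move: xy; rewrite leq_eqVlt ltnS => /orP[/eqP xy|]; last first.
    by exists x; rewrite ?nb_refl.
  have yx : x <> y by move=> e; move: xy; rewrite e gdistxx.
  have [x1 xx1 e] := gdist_step G yx.
  by exists x1; [rewrite (adj_nb G)|rewrite -ltnS -e xy].
rewrite exprS -mulrA /= /avg (bigD1_seq x1) ?(nb_uniq G)//=.
rewrite -[leLHS]addr0 lerD//.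
  apply: ler_pM; rewrite ?invr_ge0 ?mulr_ge0 ?exprn_ge0 ?invr_ge0//.
  - exact: (kernel_lb G).
  - exact: IH.
apply: sumr_ge0 => z _; apply: mulr_ge0; first exact: kernel_ge0.
exact: iter_avg_ge0.
Qed.

Lemma heat_lb n x z : (d x z <= n)%N -> (2 * D)%:R^-1 ^+ n <= heat n x z.
Proof.
move=> xz; rewrite -[leLHS]mulr1 -[X in _ * X](_ : dirac_at z z = 1).
  by apply: iter_avg_lb => // y; rewrite /dirac_at.
by rewrite /dirac_at eqxx.
Qed.

Lemma heat_gt0 n x z : (d x z <= n)%N -> 0 < heat n x z.
Proof.
move/heat_lb; apply: lt_le_trans.
by rewrite exprn_gt0// invr_gt0 ltr0n muln_gt0 (maxdeg_gt0 G).
Qed.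

(** Reversibility with respect to the degree measure. *)
Lemma heat_rev n x z :
  (deg adj x)%:R * heat n x z = (deg adj z)%:R * heat n z x.
Proof.
elim: n x z => [|n IH] x z.
  rewrite /heat /= /dirac_at eq_sym.
  by case: eqVneq => [->//|]; rewrite !mulr0.
pose s := undup (gball x n.+1 ++ gball z n.+1).
have us : uniq s by exact: undup_uniq.
have xs y : (d x y <= n.+1)%N -> y \in s.
  by move=> h; rewrite mem_undup mem_cat mem_gball h.
have zs y : (d z y <= n.+1)%N -> y \in s.
  by move=> h; rewrite mem_undup mem_cat !mem_gball h orbT.
have heat1 a b : heat 1 a b = K a b.
  rewrite /heat /= /avg.
  have [ba|ba] := boolP (b \in nb adj a).
    rewrite (bigD1_seq b) ?(nb_uniq G)//= /dirac_at eqxx mulr1 big1 ?addr0//.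
    by move=> c /negPf ->; rewrite mulr0.
  rewrite (kernel_out G ba) big_seq big1// => c ca.
  rewrite /dirac_at; case: eqVneq => [e|]; last by rewrite mulr0.
  by rewrite e (negPf ba) in ca.
have -> : heat n.+1 x z = \sum_(y <- s) heat n y z * heat 1 x y.
  rewrite -(@iter_avg_heat 1 (heat n ^~ z) x)// => y h.
  by apply: xs; rewrite (leq_trans h).
have -> : heat n.+1 z x = \sum_(y <- s) heat 1 y x * heat n z y.
  rewrite -(@iter_avg_heat n (heat 1 ^~ x) z)//; last first.
    by move=> y h; apply: zs; rewrite (leq_trans h).
  by rewrite /heat iterSr.
rewrite !mulr_sumr; apply: eq_bigr => y _; rewrite !heat1.
transitivity (heat n y z * ((deg adj y)%:R * K y x)).
  by rewrite -(kernel_rev G) mulrCA.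
by rewrite mulrA [heat n y z * _]mulrC IH -mulrA [heat n z y * _]mulrC.
Qed.

End AveragingOperator.

(** * Couplings of one lazy step *)

Section Transport.

Lemma esum_ge_seq (R : realType) (T : choiceType) (s : seq T) (a : T -> \bar R) :
  uniq s -> (\sum_(i <- s) a i <= \esum_(i in [set: T]) a i)%E.
Proof.
move=> us; apply: esum_ge; exists [set` s]; first by split.
by rewrite fsbig_seq.
Qed.

Lemma esum_seq (R : realType) (T : choiceType) (s : seq T) (a : T -> \bar R) :
  uniq s -> (forall i, (0 <= a i)%E) -> (forall i, i \notin s -> a i = 0%E) ->
  \esum_(i in [set: T]) a i = (\sum_(i <- s) a i)%E.
Proof.
move=> us a0 aout; rewrite fsbig_seq// -esum_fset//.
rewrite [RHS]esum_mkcond; apply: eq_esum => i _.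
by case: ifPn => //; rewrite mem_setE => /aout.
Qed.

Variables (R : realType) (V : choiceType) (adj : rel V) (D : nat).
Hypothesis G : curved_graph R adj D.
Implicit Types (x y z : V) (n m : nat) (f g : V -> R).
Local Notation d := (gdist adj).
Local Notation K := (lazy_kernel R adj).
Local Notation nb := (nb adj).

(** Couplings of the two one-step laws of expected distance at most [c], as
    finite sums over the supports rather than sums over [V]. *)
Definition step_coupling x y (c : R) : Prop :=
  exists q : V -> V -> R, [/\ forall u v, 0 <= q u v,
    forall u, u \in nb x -> \sum_(v <- nb y) q u v = K x u,
    forall v, v \in nb y -> \sum_(u <- nb x) q u v = K y v &
    \sum_(u <- nb x) \sum_(v <- nb y) q u v * (d u v)%:R <= c].

(** The curvature bound. The infimum defining the transport cost is only
    approached, hence the error [e]; couplings vanish off the supports of their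
    marginals, which turns the infinite sums into finite ones. *)
Lemma step_coupling_adj x y e : adj x y -> 0 < e -> step_coupling x y (1 + e).
Proof.
move=> xy e0.
have : (W1 adj (K x) (K y) < (1 + e)%:E)%E.
  by apply: le_lt_trans (cg_curv G xy) _; rewrite lte_fin ltrDl.
move=> /ereal_inf_lt[_ [q [q0 q1 q2] <-] qe].
have q1out u v : u \notin nb x -> q (u, v) = 0.
  move=> ux; apply/eqP; rewrite eq_le q0 andbT.
  have := @esum_ge_seq R V [:: v] (fun v => (q (u, v))%:E) isT.
  by rewrite big_seq1 q1 (kernel_out G ux) lee_fin.
have q2out u v : v \notin nb y -> q (u, v) = 0.
  move=> vy; apply/eqP; rewrite eq_le q0 andbT.
  have := @esum_ge_seq R V [:: u] (fun u => (q (u, v))%:E) isT.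
  by rewrite big_seq1 q2 (kernel_out G vy) lee_fin.
exists (fun u v => q (u, v)); split=> //.
- move=> u _; apply: EFin_inj; rewrite -q1 (@esum_seq _ _ (nb y))// ?sumEFin//.
  + exact: (nb_uniq G).
  + by move=> v; rewrite lee_fin.
  + by move=> v vy; rewrite q2out.
- move=> v _; apply: EFin_inj; rewrite -q2 (@esum_seq _ _ (nb x))// ?sumEFin//.
  + exact: (nb_uniq G).
  + by move=> u; rewrite lee_fin.
  + by move=> u ux; rewrite q1out.
rewrite -lee_fin; apply: le_trans (ltW qe).
have := @esum_ge_seq R _ [seq (u, v) | u <- nb x, v <- nb y]
  (fun uv => ((d uv.1 uv.2)%:R * q uv)%:E).
rewrite big_allpairs -sumEFin => H; apply: le_trans (H _).
  apply: lee_sum => u _; rewrite -sumEFin lee_sum// => v _.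
  by rewrite mulrC.
by apply: allpairs_uniq; rewrite ?(nb_uniq G)// => -[? ?] [].
Qed.

Lemma step_coupling_refl x : step_coupling x x 0.
Proof.
exists (fun u v => (u == v)%:R * K x u); split.
- by move=> u v; rewrite mulr_ge0// kernel_ge0.
- move=> u ux; rewrite (bigD1_seq u) ?(nb_uniq G)//= eqxx mul1r big1 ?addr0//.
  by move=> v; rewrite eq_sym => /negPf ->; rewrite mul0r.
- move=> u ux; rewrite (bigD1_seq u) ?(nb_uniq G)//= eqxx mul1r big1 ?addr0//.
  by move=> v /negPf ->; rewrite mul0r.
rewrite big1// => u _; rewrite big1// => v _.
by case: eqVneq => [->|_]; rewrite ?gdistxx ?mulr0// !mul0r.
Qed.

(** Gluing: the two couplings are made conditionally independent given the
    middle point. *)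
Lemma step_coupling_trans x y z a b :
  step_coupling x y a -> step_coupling y z b -> step_coupling x z (a + b).
Proof.
move=> [q [q0 q1 q2 qa]] [r [r0 r1 r2 rb]].
have K0 v : v \in nb y -> K y v != 0 by move=> vy; rewrite gt_eqF// (kernel_gt0 G).
pose s u w := \sum_(v <- nb y) q u v * r v w / K y v.
have s1 u (h : V -> V -> R) : \sum_(w <- nb z) \sum_(v <- nb y)
    q u v * r v w / K y v * h u v = \sum_(v <- nb y) q u v * h u v.
  rewrite exchange_big/= big_seq [RHS]big_seq; apply: eq_bigr => v vy.
  transitivity (\sum_(w <- nb z) (q u v / K y v * h u v) * r v w).
    by apply: eq_bigr => w _; ring.
  by rewrite -mulr_sumr r1// mulrAC divfK// K0.
have s2 w (h : V -> V -> R) : \sum_(u <- nb x) \sum_(v <- nb y)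
    q u v * r v w / K y v * h v w = \sum_(v <- nb y) r v w * h v w.
  rewrite exchange_big/= big_seq [RHS]big_seq; apply: eq_bigr => v vy.
  transitivity (\sum_(u <- nb x) (r v w / K y v * h v w) * q u v).
    by apply: eq_bigr => u _; ring.
  by rewrite -mulr_sumr q2// mulrAC divfK// K0.
exists s; split.
- move=> u w; apply: sumr_ge0 => v _.
  by rewrite mulr_ge0 ?mulr_ge0// invr_ge0 kernel_ge0.
- move=> u ux; rewrite -(q1 u ux); have := s1 u (fun _ _ => 1).
  rewrite [X in _ = X -> _](eq_bigr (q u)) => [<-|v _]; last by rewrite mulr1.
  by apply: eq_bigr => w _; apply: eq_bigr => v _; rewrite mulr1.
- move=> w wz; rewrite -(r2 w wz); have := s2 w (fun _ _ => 1).
  rewrite [X in _ = X -> _](eq_bigr (r ^~ w)) => [<-|v _]; last by rewrite mulr1.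
  by apply: eq_bigr => u _; apply: eq_bigr => v _; rewrite mulr1.
apply: le_trans (lerD qa rb).
have -> : \sum_(u <- nb x) \sum_(v <- nb y) q u v * (d u v)%:R =
    \sum_(u <- nb x) \sum_(w <- nb z) \sum_(v <- nb y)
      q u v * r v w / K y v * (d u v)%:R.
  by apply: eq_bigr => u _; rewrite -(s1 u (fun u v => (d u v)%:R)).
have -> : \sum_(v <- nb y) \sum_(w <- nb z) r v w * (d v w)%:R =
    \sum_(u <- nb x) \sum_(w <- nb z) \sum_(v <- nb y)
      q u v * r v w / K y v * (d v w)%:R.
  rewrite exchange_big [RHS]exchange_big/=; apply: eq_bigr => w _.
  by rewrite -(s2 w (fun v w => (d v w)%:R)).
rewrite -big_split/=.
apply: ler_sum => u _; rewrite -big_split/=; apply: ler_sum => w _.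
rewrite /s mulr_suml -big_split/=; apply: ler_sum => v _.
rewrite -mulrDr ler_wpM2l//.
  by rewrite mulr_ge0 ?mulr_ge0// invr_ge0 kernel_ge0.
by rewrite -natrD ler_nat (gdist_triangle G).
Qed.

(** Curvature along edges controls all pairs: glue along a geodesic. *)
Lemma step_coupling_dist x y e : 0 < e -> step_coupling x y ((d x y)%:R + e).
Proof.
move xy : (d x y) => n; elim: n x e xy => [|n IH] x e xy e0.
  move/(gdist_eq0 G) : xy => <-; case: (step_coupling_refl x) => q [? ? ? q0].
  by exists q; split=> //; apply: le_trans q0 _; rewrite add0r ltW.
have yx : x <> y by move=> h; move: xy; rewrite h gdistxx.
have [x1 xx1 x1y] := gdist_step G yx.
have e2 : 0 < e / 2 by rewrite divr_gt0.
have -> : n.+1%:R + e = (1 + e / 2) + (n%:R + e / 2) by rewrite -natr1; field.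
apply: (@step_coupling_trans _ x1); first exact: step_coupling_adj.
by apply: IH => //; apply: succn_inj; rewrite -x1y.
Qed.

End Transport.

(** * Costs of chasing, for one step *)

Section ChasingCost.
Variables (R : realType) (V : choiceType) (adj : rel V) (D : nat).
Hypothesis G : curved_graph R adj D.
Implicit Types (x y z : V) (n m k : nat) (f g : V -> R) (s a b : R).
Local Notation d := (gdist adj).
Local Notation K := (lazy_kernel R adj).
Local Notation nb := (nb adj).
Local Notation avg := (avg adj).

Lemma ln_le_sub1 (t : R) : 0 < t -> ln t <= t - 1.
Proof.
by move=> t0; rewrite -{1}[t](subrKC 1) le_ln1Dx// ltrBrDl subrr.
Qed.

(** With horizon [s], catching up with a point at distance [a] costs about
    [a ^+ 2 / s] when [a] is at most [s], but only a multiple of [a] beyond, since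
    following a path edge by edge has bounded cost per edge. This function has
    both regimes and, unlike their minimum, is smooth and convex. *)
Definition huber s a : R := a ^+ 2 / (s + a).

Definition huber_slope s a : R := (a ^+ 2 + 2 * s * a) / (s + a) ^+ 2.

Lemma huber_slope_ge0 s a : 0 < s -> 0 <= a -> 0 <= huber_slope s a.
Proof.
move=> s0 a0; apply: mulr_ge0; last by rewrite invr_ge0 exprn_ge0// addr_ge0// ltW.
by rewrite addr_ge0 ?exprn_ge0// !mulr_ge0// ltW.
Qed.

(** A coupling controls the mean of the new distance only. Linearising the cost
    at the current distance leaves a quadratic error, which stays of order [1 / s]
    because one step changes the distance by at most 2. *)
Lemma huber_tangent s a b : 0 < s -> 0 <= a -> 0 <= b ->
  huber s b <= huber s a + huber_slope s a * (b - a) + (b - a) ^+ 2 / s.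
Proof.
move=> s0 a0 b0; have sa : 0 < s + a by rewrite ltr_pwDl.
have sb : 0 < s + b by rewrite ltr_pwDl.
have -> : huber s b = huber s a + huber_slope s a * (b - a) +
    (b - a) ^+ 2 * (s ^+ 2 / ((s + a) ^+ 2 * (s + b))).
  rewrite /huber /huber_slope; field.
  by rewrite !gt_eqF.
rewrite lerD2l ler_wpM2l ?sqr_ge0//.
rewrite ler_pdivrMr ?mulr_gt0 ?exprn_gt0// ler_pdivlMl//.
rewrite mulrC; apply: ler_pM; rewrite ?exprn_ge0 ?lerDl// ?(ltW s0)//.
by rewrite lerXn2r ?nnegrE ?lerDl// ltW.
Qed.

(** The chasing rate is half of [a / (s + a)]: with this choice, the decrease of
    the cost due to the shorter distance pays both for the entropy spent and for
    the decrease of the cost as the horizon grows. *)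
Lemma huber_decay s a : 0 < s -> 0 <= a ->
  (a / (s + a) / 2) ^+ 2 / 2 - huber_slope s a * (a / (s + a) / 4)
    <= huber (s + 8^-1) a - huber s a.
Proof.
move=> s0 a0 /=; set u := a / (s + a); have sa : 0 < s + a by rewrite ltr_pwDl.
have sa8 : 0 < s + 8^-1 + a by rewrite ltr_pwDl// addr_gt0.
have u0 : 0 <= u by rewrite divr_ge0// ltW.
have u1 : u <= 1 by rewrite ler_pdivrMr// mul1r lerDr ltW.
have -> : huber_slope s a = u * (2 - u).
  by rewrite /huber_slope /u; field; rewrite gt_eqF.
have -> : huber (s + 8^-1) a - huber s a =
    - 8^-1 * (u * (a / (s + 8^-1 + a))).
  rewrite /huber /u; field.
  by rewrite !gt_eqF// ; lra.
have : a / (s + 8^-1 + a) <= u.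
  by rewrite ler_wpM2l// lef_pV2 ?posrE// lerD2r lerDl.
move: (a / _) => v vu.
have : u * v <= u * u by rewrite ler_wpM2l.
have : u * (u * u) <= u * u by rewrite ler_piMl// mulr_ge0.
nra.
Qed.

(** Gibbs variational inequality for the kernel at [x] tilted towards one
    neighbour. The relative entropy of the tilted kernel is at most its
    chi-square divergence, at most [e ^+ 2 / K x x1]; this is where bounded degree
    enters. *)
Lemma tilted_ln_le x x1 (e : R) g : x1 \in nb x -> 0 <= e < 1 ->
    (forall z, 0 < g z) ->
  (1 - e) * avg (fun z => ln (g z)) x + e * ln (g x1)
    <= ln (avg g x) + 2 * D%:R * e ^+ 2.
Proof.
move=> xx1 /andP[e0 e1] g0.
have p0 : 0 < K x x1 by exact: (kernel_gt0 G).
have M0 : 0 < avg g x.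
  rewrite /avg (bigD1_seq x1) ?(nb_uniq G)//=.
  apply: ltr_wpDr; last exact: mulr_gt0.
  by apply: sumr_ge0 => z _; apply: mulr_ge0; rewrite ?kernel_ge0 ?ltW.
(* [r] is the density of the tilted kernel with respect to [K x]. *)
pose r z : R := (1 - e) + e * (dirac_at R z x1 / K x x1).
have r0 z : 0 < r z.
  apply: ltr_wpDr; last by rewrite subr_gt0.
  by apply: mulr_ge0 => //; apply: divr_ge0; rewrite ?(ltW p0)// /dirac_at.
have avgr (F : V -> R) : avg (fun z => r z * F z) x = (1 - e) * avg F x + e * F x1.
  rewrite -avgZ.
  have -> : e * F x1 = avg (fun z => e * F z / K x x1 * dirac_at R z x1) x.
    rewrite /avg; under eq_bigr do rewrite mulrA.
    rewrite (@sum_dirac _ _ _ (fun z => K x z * (e * F z / K x x1)))//.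
      by field; exact: lt0r_neq0.
    exact: (nb_uniq G).
  by rewrite -avgD; apply: eq_bigr => z _; rewrite /r; ring.
have key z : r z * ln (g z) <= (avg g x)^-1 * g z + r z * (r z - 2 + ln (avg g x)).
  have -> : ln (g z) = ln (g z / (r z * avg g x)) + ln (r z) + ln (avg g x).
    have rM : 0 < r z * avg g x by rewrite mulr_gt0.
    rewrite -{1}[g z](divfK (lt0r_neq0 rM)) (lnM (divr_gt0 (g0 z) rM) rM).
    by rewrite (lnM (r0 z) M0) addrA.
  have h1 : r z * ln (g z / (r z * avg g x)) <= (avg g x)^-1 * g z - r z.
    apply: le_trans (_ : r z * (g z / (r z * avg g x) - 1) <= _).
      by rewrite ler_wpM2l ?(ltW (r0 z))// ln_le_sub1// divr_gt0// mulr_gt0.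
    by rewrite le_eqVlt; apply/orP; left; apply/eqP; field; rewrite !gt_eqF.
  have h2 : r z * ln (r z) <= r z * (r z - 1).
    by rewrite ler_wpM2l ?(ltW (r0 z))// ln_le_sub1.
  apply: le_trans (_ : (avg g x)^-1 * g z - r z + r z * (r z - 1) +
    r z * ln (avg g x) <= _); last by rewrite le_eqVlt; apply/orP; left; apply/eqP; ring.
  by rewrite [X in X <= _]mulrDr [X in X + _ <= _]mulrDr lerD2r lerD.
rewrite -(avgr (fun z => ln (g z))).
apply: le_trans; first by apply: avg_le => z _; exact: key.
rewrite avgD avgZ mulVf ?gt_eqF// (avgr (fun z => r z - 2 + ln (avg g x))).
rewrite (avgD _ (fun z => r z - 2)) (avgD _ r) !(avg_cst G).
have -> : avg r x = 1.
  rewrite -[RHS](_ : (1 - e) * avg (fun=> 1) x + e * 1 = 1).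
    by rewrite -avgr; apply: eq_bigr => z _; rewrite mulr1.
  by rewrite (avg_cst G); ring.
have : e ^+ 2 / K x x1 <= 2 * D%:R * e ^+ 2.
  rewrite mulrC ler_wpM2r ?sqr_ge0//.
  have := kernel_lb G xx1; rewrite -[leRHS]invrK lef_pV2 ?posrE ?invr_gt0//.
    by rewrite natrM.
  by rewrite ltr0n muln_gt0 (maxdeg_gt0 G).
rewrite /r /dirac_at eqxx.
have -> : 1 - e + e * (1%:R / K x x1) - 2 + ln (avg g x) =
  e / K x x1 - 1 - e + ln (avg g x) by field; rewrite gt_eqF.
have -> : e * (e / K x x1 - 1 - e + ln (avg g x)) =
  e ^+ 2 / K x x1 + e * (- 1 - e + ln (avg g x)) by ring.
have := sqr_ge0 e; nra.
Qed.

End ChasingCost.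

(** * The dimension-free Harnack inequality *)

Section LogHarnack.
Variables (R : realType) (V : choiceType) (adj : rel V) (D : nat).
Hypothesis G : curved_graph R adj D.
Implicit Types (x y z : V) (n m k : nat) (f g : V -> R) (s a b : R).
Local Notation d := (gdist adj).
Local Notation K := (lazy_kernel R adj).
Local Notation nb := (nb adj).
Local Notation avg := (avg adj).

(** One step of the chase. With probability [1 - e] the two walkers move by an
    almost optimal coupling, which does not increase their mean distance; with
    probability [e] the first one moves to [x1], closer to [y], while the other
    one makes a lazy step, which gains [1 / 2] on average. *)
Lemma avg_coupled x y x1 e (F g : V -> R) a b :
  0 <= e <= 1 -> 0 <= b -> adj x x1 -> d x y = (d x1 y).+1 ->
  (forall u v, u \in nb x -> v \in nb y -> F v <= g u + a + b * (d u v)%:R) ->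
  avg F y <= (1 - e) * avg g x + e * g x1 + a + b * ((d x y)%:R - e / 2).
Proof.
move=> /andP[e0 e1] b0 xx1 dxy Fg; apply/ler_addgt0Pr => t t0.
have b1 : 0 < b + 1 by rewrite ltr_wpDl.
have [q [q0 q1 q2 qc]] := step_coupling_dist G x y (divr_gt0 t0 b1).
have parallel : avg F y <= avg g x + a + b * ((d x y)%:R + t / (b + 1)).
  have -> : avg F y = \sum_(u <- nb x) \sum_(v <- nb y) q u v * F v.
    rewrite exchange_big/= /avg big_seq [RHS]big_seq; apply: eq_bigr => v vy.
    by rewrite -mulr_suml q2.
  have -> : avg g x + a =
      \sum_(u <- nb x) \sum_(v <- nb y) q u v * (g u + a).
    rewrite -[a in LHS](avg_cst G a x) -avgD /avg big_seq [RHS]big_seq.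
    by apply: eq_bigr => u ux; rewrite -mulr_suml q1.
  apply: le_trans (lerD (lexx _) (ler_wpM2l b0 qc)).
  rewrite mulr_sumr -big_split/= big_seq [leRHS]big_seq; apply: ler_sum => u ux.
  rewrite mulr_sumr -big_split/= big_seq [leRHS]big_seq; apply: ler_sum => v vy.
  by rewrite mulrCA -mulrDr ler_wpM2l// Fg.
have chase : avg F y <= g x1 + a + b * ((d x y)%:R - 1 / 2).
  have h v : v \in nb y ->
      F v <= g x1 + a + b * ((d x y)%:R - 1 + (1 - dirac_at R y v)).
    move=> vy; apply: le_trans (Fg x1 v (adj_nb G xx1) vy) _.
    rewrite lerD2l ler_wpM2l// dxy -natr1 addrK /dirac_at.
    have [->|vny] := eqVneq v y; first by rewrite subrr addr0.
    rewrite subr0 natr1 ler_nat; apply: leq_trans (gdist_triangle G x1 y v) _.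
    by rewrite -addn1 leq_add2l; apply/(nbP G).
  apply: le_trans (avg_le h) _.
  rewrite (avgD _ (fun=> g x1 + a)) (avgZ _ b).
  rewrite (avgD _ (fun=> (d x y)%:R - 1)) (avgD _ (fun=> 1)) !(avg_cst G).
  rewrite lerD2l ler_wpM2l//.
  have -> : avg (fun v => - dirac_at R y v) y = - (1 / 2).
    rewrite /avg (eq_bigr (fun v => - K y v * dirac_at R v y)) => [|v _].
      rewrite sum_dirac ?(nb_uniq G) ?nb_refl//.
      by rewrite (kernelxx G) mul1r.
    by rewrite /dirac_at eq_sym mulrN mulNr.
  lra.
have H1 : (1 - e) * avg F y <=
    (1 - e) * (avg g x + a + b * ((d x y)%:R + t / (b + 1))).
  by rewrite ler_wpM2l// subr_ge0.
have H2 := ler_wpM2l e0 chase.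
have H3 : (1 - e) * (b * (t / (b + 1))) <= t.
  apply: le_trans (_ : b * (t / (b + 1)) <= _).
    by rewrite ler_piMl ?gerBl// mulr_ge0// divr_ge0// ltW.
  by rewrite mulrCA ler_piMr ?(ltW t0)// ler_pdivrMr// mul1r lerDl.
move: H1 H2 H3; rewrite !mulrDr; nra.
Qed.

(** Law of the walk at time [m] plus an independent geometric time, truncated at
    [k]. Thanks to the random extra time, already for [m = 0] the expectation of
    [f] from [x] is at least [f y] up to a factor [4 D] per unit of distance. This
    starts the induction below; no fixed time has this property. *)
Definition resolvent k m f x : R :=
  \sum_(i < k) 2^-1 ^+ i.+1 * iter (m + i) avg f x.

Lemma resolventS k m f x : resolvent k m.+1 f x = avg (resolvent k m f) x.
Proof.
have := iter_avg_sum G 1 (index_enum 'I_k)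
  (fun i y => 2^-1 ^+ i.+1 * iter (m + i) avg f y) x.
by move=> /= ->; apply: eq_bigr => i _; rewrite avgZ.
Qed.

Lemma resolvent_gt0 k m f x : (0 < k)%N -> (forall z, 0 < f z) ->
  0 < resolvent k m f x.
Proof.
case: k => // k _ f0; rewrite /resolvent big_ord_recl/=; apply: ltr_wpDr.
  apply: sumr_ge0 => i _; apply: mulr_ge0; first by rewrite exprn_ge0.
  by apply: (iter_avg_ge0 G) => z; rewrite ltW.
apply: mulr_gt0; first by rewrite exprn_gt0.
have f0' z : 0 <= f z by rewrite ltW.
apply: lt_le_trans (iter_avg_lb G f0' (_ : (d x x <= _)%N)); last by rewrite gdistxx.
by rewrite mulr_gt0// exprn_gt0// invr_gt0 ltr0n muln_gt0 (maxdeg_gt0 G).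
Qed.

(** The second term accumulates the linearisation errors of [huber], of order
    [1 / i] when [i] steps remain; it is logarithmic in [m]. The last one makes up
    for the start of the induction. *)
Definition harnack_cost m (a : R) : R :=
  4 * D%:R * huber (m.+1%:R / 8) a +
  128 * D%:R * (\sum_(i < m) i.+1%:R^-1) + (ln 2 + D%:R / 2).

(** A log-Harnack inequality in the spirit of F.-Y. Wang, by coupling with change
    of measure: a walker started at [x] chases the walker started at [y], by tilting
    its kernel, and the relative entropy of the tilts is the price. The induction
    on [m] is the dynamic programming version of this coupling. Curvature enters
    only through the mean distance after one step, and the price does not depend
    on volume growth. *)
Theorem log_harnack f k m x y : (forall z, 0 < f z) ->
    (d x y + 2 * m < k)%N ->
  iter m avg (fun z => ln (f z)) y <=
    ln (resolvent k m f x) + harnack_cost m (d x y)%:R.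
Proof.
move=> f0; have D0 : 0 < D%:R :> R by rewrite ltr0n (maxdeg_gt0 G).
elim: m x y => [|m IH] x y xyk.
  rewrite muln0 addn0 in xyk; rewrite /harnack_cost big_ord0 mulr0 addr0 /=.
  set n := d x y in xyk *.
  have lb : f y <= 2 * (4 * D%:R) ^+ n * resolvent k 0 f x.
    have : 2^-1 ^+ n.+1 * ((2 * D)%:R^-1 ^+ n * f y) <= resolvent k 0 f x.
      rewrite /resolvent (bigD1 (Ordinal xyk))//= -[leLHS]addr0 lerD//.
        rewrite ler_wpM2l ?exprn_ge0//; apply: (iter_avg_lb G) => // z.
        exact: ltW.
      apply: sumr_ge0 => i _; apply: mulr_ge0; first by rewrite exprn_ge0.
      by apply: (iter_avg_ge0 G) => z; rewrite ltW.
    rewrite mulrA -ler_pdivlMl; last first.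
      by rewrite mulr_gt0// exprn_gt0// invr_gt0 ltr0n muln_gt0 (maxdeg_gt0 G).
    congr (_ <= _ * _).
    rewrite !exprVn -invfM invrK exprS natrM -mulrA -exprMn.
    by congr (_ * _ ^+ _); ring.
  have Q0 : 0 < resolvent k 0 f x by apply: resolvent_gt0 => //; exact: leq_ltn_trans xyk.
  have D4 : 0 < 4 * D%:R :> R by rewrite mulr_gt0.
  apply: le_trans (_ : ln (2 * (4 * D%:R) ^+ n * resolvent k 0 f x) <= _).
    by rewrite ler_ln ?posrE ?mulr_gt0// ?exprn_gt0.
  rewrite !lnM ?posrE ?mulr_gt0// ?exprn_gt0// lnXn// addrC lerD2l.
  rewrite [leRHS]addrCA lerD2l -(mulr_natr (ln _) n).
  apply: le_trans (_ : 4 * D%:R * n%:R <= _).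
    by rewrite ler_wpM2r// ltW// ln_sublinear.
  have -> : D%:R / 2 = 4 * D%:R * 8^-1 :> R by field.
  rewrite -mulrDr ler_wpM2l ?(ltW D4)// /huber mul1r.
  have n8 : 0 < 8^-1 + n%:R :> R by rewrite ltr_wpDr.
  rewrite -lerBlDr ler_pdivlMr//; have : 0 <= n%:R :> R by []; lra.
have s0 : 0 < m.+1%:R / 8 :> R by rewrite divr_gt0.
set s := _ / 8 in s0.
have costS a : harnack_cost m.+1 a = 4 * D%:R * huber (s + 8^-1) a + 16 * D%:R / s +
    (128 * D%:R * (\sum_(i < m) i.+1%:R^-1) + (ln 2 + D%:R / 2)).
  rewrite /harnack_cost big_ord_recr/= /s.
  have -> : m.+2%:R / 8 = m.+1%:R / 8 + 8^-1 :> R by rewrite -(natr1 m.+1); field.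
  have : m.+1%:R != 0 :> R by rewrite pnatr_eq0.
  by move: (m.+1%:R) => M M0; field.
set c := 128 * D%:R * _ + _ in costS.
have cost a : harnack_cost m a = 4 * D%:R * huber s a + c by rewrite /harnack_cost -addrA.
clearbody c.
have Q0 z : 0 < resolvent k m f z.
  by apply: resolvent_gt0 => //; exact: leq_ltn_trans xyk.
have [xy|/eqP xy] := eqVneq x y.
  (* The walkers have met and stay together: only Jensen's inequality is used. *)
  rewrite -xy gdistxx /= resolventS; rewrite -xy gdistxx in xyk.
  apply: le_trans (_ : avg (fun z => ln (resolvent k m f z) + harnack_cost m 0) x <= _).
    apply: avg_le => z _; have := IH z z; rewrite gdistxx; apply.
    by apply: leq_ltn_trans xyk; rewrite !add0n leq_mul2l leqnSn.
  rewrite avgD (avg_cst G) lerD//.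
    have := @tilted_ln_le R V adj D G x x 0 (resolvent k m f) (nb_refl adj x).
    by rewrite subr0 !mul1r !mul0r expr0n mulr0 !addr0; apply=> //; rewrite lexx ltr01.
  rewrite cost costS lerD2r /huber expr0n/= !mul0r mulr0 add0r.
  by apply: divr_ge0; rewrite ?(ltW s0)// mulr_ge0.
have [x1 xx1 dxy] := gdist_step G xy.
set a : R := (d x y)%:R.
have a0 : 0 <= a by rewrite /a.
have sa : 0 < s + a by rewrite ltr_wpDr.
pose e := a / (s + a) / 2.
have e0 : 0 <= e by rewrite !divr_ge0// ltW.
have e1 : e < 1.
  have : a / (s + a) <= 1 by rewrite ler_pdivrMr// mul1r lerDr ltW.
  by rewrite /e; lra.
pose b := 4 * D%:R * huber_slope s a.
have b0 : 0 <= b by rewrite mulr_ge0 ?huber_slope_ge0// mulr_ge0.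
rewrite iterS resolventS.
(* The cost at time [m] is replaced by its tangent at the current distance. *)
have := @avg_coupled x y x1 e (iter m avg (fun z => ln (f z)))
  (fun z => ln (resolvent k m f z))
  (4 * D%:R * (huber s a + 4 / s) + c - b * a) b.
have -> : 0 <= e <= 1 by rewrite e0 ltW.
move=> /(_ isT b0 xx1 dxy) H; apply: le_trans (H _) _.
  move=> u v ux vy; have uv := gdist_nb2 G ux vy.
  apply: le_trans (IH u v _) _.
    by apply: leq_ltn_trans xyk; move: uv; clear; lia.
  rewrite cost -!addrA lerD2l.
  have near2 : ((d u v)%:R - a) ^+ 2 <= 4.
    have h1 : (d u v)%:R <= a + 2 by rewrite -natrD ler_nat.
    have h2 : a <= (d u v)%:R + 2.
      rewrite -natrD ler_nat; by apply: (gdist_nb2 G); rewrite (nb_sym G).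
    by nra.
  have duv0 : 0 <= (d u v)%:R :> R by [].
  have := huber_tangent s0 a0 duv0.
  have : ((d u v)%:R - a) ^+ 2 / s <= 4 / s by rewrite ler_pM2r ?invr_gt0.
  have D4 : 0 <= 4 * D%:R :> R by rewrite mulr_ge0.
  move=> h1 h2; have := ler_wpM2l D4 (le_trans h2 (lerD (lexx _) h1)).
  by rewrite /b; lra.
have := tilted_ln_le G (adj_nb G xx1) (_ : 0 <= e < 1) Q0.
rewrite e0 e1 => /(_ isT) tilt.
rewrite costS -!addrA.
have := huber_decay s0 a0.
rewrite -[a / (s + a) / 2]/e (_ : a / (s + a) / 4 = e / 2); last by rewrite /e; field; rewrite gt_eqF.
move=> /(ler_wpM2l (ltW D0)) decay; move: tilt decay; rewrite /b !mulrBr !mulrDr.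
move: (huber _ _) (huber _ _) (huber_slope _ _) => h1 h2 h3.
lra.
Qed.

End LogHarnack.

(** * Entropy of the walk *)

Section Entropy.
Variables (R : realType) (V : choiceType) (adj : rel V) (D : nat).
Hypothesis G : curved_graph R adj D.
Implicit Types (x y z : V) (n m k : nat) (f g : V -> R).
Local Notation d := (gdist adj).
Local Notation avg := (avg adj).
Local Notation heat := (heat R adj).
Local Notation dirac := (dirac_at R).

Lemma resolvent_le k m f g x : (forall z, f z <= g z) ->
  resolvent adj k m f x <= resolvent adj k m g x.
Proof.
move=> fg; apply: ler_sum => i _; rewrite ler_wpM2l ?exprn_ge0//.
exact: (iter_avg_le G).
Qed.

Lemma resolventD k m f g x : resolvent adj k m (fun y => f y + g y) x =
  resolvent adj k m f x + resolvent adj k m g x.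
Proof.
by rewrite -big_split; apply: eq_bigr => i _; rewrite iter_avgDl mulrDr.
Qed.

Lemma resolvent_dirac k m (s : seq V) (c : V -> R) x :
  resolvent adj k m (fun y => \sum_(z <- s) c z * dirac z y) x =
  \sum_(z <- s) c z * resolvent adj k m (dirac z) x.
Proof.
rewrite /resolvent; under [RHS]eq_bigr do rewrite mulr_sumr.
rewrite [RHS]exchange_big/=; apply: eq_bigr => i _.
rewrite (iter_avg_sum G) mulr_sumr; apply: eq_bigr => z _.
by rewrite iter_avgZ; ring.
Qed.

Lemma resolvent1_le k m x : resolvent adj k m (fun=> 1) x <= 1 :> R.
Proof.
rewrite /resolvent; under eq_bigr do rewrite (iter_avg_cst G) mulr1.
suff -> : \sum_(i < k) 2^-1 ^+ i.+1 = 1 - 2^-1 ^+ k :> R.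
  by rewrite gerBl exprn_ge0.
elim: k => [|k IH]; first by rewrite big_ord0 expr0 subrr.
by rewrite big_ord_recr/= IH exprS; field.
Qed.

Lemma resolvent_dirac_gt0 k m s x z : (s < k)%N -> (d x z <= m + s)%N ->
  0 < resolvent adj k m (dirac z) x.
Proof.
move=> sk xz; rewrite /resolvent (bigD1 (Ordinal sk))//=.
apply: ltr_wpDr.
  apply: sumr_ge0 => i _; apply: mulr_ge0; first by rewrite exprn_ge0.
  exact: (heat_ge0 G).
apply: mulr_gt0; first by rewrite exprn_gt0.
exact: (heat_gt0 G).
Qed.

Lemma sum_resolvent_dirac_le1 k m (s : seq V) x : uniq s ->
  \sum_(z <- s) resolvent adj k m (dirac z) x <= 1.
Proof.
move=> us; apply: le_trans (resolvent1_le k m x).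
have := resolvent_dirac k m s (fun=> 1 : R) x.
under [in RHS]eq_bigr do rewrite mul1r.
move=> <-; apply: resolvent_le => y.
under eq_bigr => z _ do rewrite -[1]/((fun=> 1 : R) z).
have [ys|ys] := boolP (y \in s); first by rewrite sum_dirac.
rewrite big_seq big1// => z zs; rewrite /dirac_at.
case: eqVneq => [e|_]; last by rewrite mulr0.
by rewrite e zs in ys.
Qed.

(** Shannon entropy of the law of the walk from [x] at time [n]. *)
Definition entropy n x : R := iter n avg (fun z => - ln (heat n x z)) x.

(** Gibbs' inequality: a subprobability [q] gives a larger cross entropy. *)
Lemma entropy_le_cross n x (q : V -> R) :
  (forall z, (d x z <= n)%N -> 0 < q z) ->
  (forall s : seq V, uniq s -> \sum_(z <- s) q z <= 1) ->
  entropy n x <= iter n avg (fun z => - ln (q z)) x.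
Proof.
move=> q0 q1.
apply: le_trans (_ : iter n avg
    (fun z => - ln (q z) + (q z / heat n x z + - 1)) x <= _).
  apply: (iter_avg_le G) => z xz.
  have p0 : 0 < heat n x z by exact: (heat_gt0 G).
  have := ln_le_sub1 (divr_gt0 (q0 z xz) p0).
  by rewrite ln_div ?posrE ?q0//; lra.
rewrite !iter_avgDl (iter_avg_cst G) gerDl subr_le0.
rewrite (@iter_avg_heat _ _ _ _ G n _ x (gball adj x n)).
- apply: le_trans (q1 (gball adj x n) (gball_uniq _ _ _)).
  rewrite le_eqVlt; apply/orP; left; apply/eqP; apply: eq_big_seq => z.
  by rewrite (mem_gball G) => /(heat_gt0 G) p0; rewrite divfK ?gt_eqF.
- exact: gball_uniq.
- by move=> z; rewrite (mem_gball G).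
Qed.

(** The entropy gained when [T] more steps are prepended is the information that
    the final position carries about the position [a] after [T] steps. It is at
    most the mean relative entropy of the laws from [a] with respect to any fixed
    subprobability; the resolvent law from [x] is chosen, so that the Harnack
    inequality bounds each of these relative entropies. *)
Theorem entropy_step T m x (h : R) : (forall a, entropy m a <= h) ->
  entropy (T + m) x <=
    h + iter T avg (fun a => harnack_cost D m (d x a)%:R) x + ln 2.
Proof.
move=> Hh.
(* The largest truncation needed by the Harnack inequality at distance [T]. *)
pose k := (T + 2 * m).+1; pose nu z := resolvent adj k m (dirac z) x.
have nu0 z : (d x z <= T + m)%N -> 0 < nu z.
  move=> xz; apply: (@resolvent_dirac_gt0 _ _ T); last by rewrite addnC.
  by rewrite ltnS leq_addr.
have nu1 (s : seq V) : uniq s -> \sum_(z <- s) nu z <= 1.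
  exact: sum_resolvent_dirac_le1.
apply: le_trans (entropy_le_cross nu0 nu1) _; rewrite iter_avgD.
have -> : h + iter T avg (fun a => harnack_cost D m (d x a)%:R) x + ln 2 =
    iter T avg (fun a => h + harnack_cost D m (d x a)%:R + ln 2) x.
  by rewrite !iter_avgDl !(iter_avg_cst G).
apply: (iter_avg_le G) => a xa.
have near z : (d a z <= m)%N -> 0 < nu z.
  move=> az; apply: nu0; apply: leq_trans (gdist_triangle G x a z) _.
  exact: leq_add.
pose f z := if (d a z <= m)%N then heat m a z / nu z else 1.
have f0 z : 0 < f z.
  rewrite /f; case: ifPn => // az.
  by rewrite divr_gt0 ?near// (heat_gt0 G).
have xak : (d x a + 2 * m < k)%N by rewrite ltnS leq_add2r.
have := log_harnack G f0 xak.
have -> : iter m avg (fun z => ln (f z)) a =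
    iter m avg (fun z => - ln (nu z)) a - entropy m a.
  rewrite /entropy -[- iter m _ _ _]mulN1r -iter_avgZ -iter_avgDl.
  apply: (iter_avg_local G) => z az; rewrite /f az mulN1r opprK addrC.
  by rewrite ln_div ?posrE ?near// (heat_gt0 G).
(* The value 1 of [f] off the ball adds at most 1 to the total mass. *)
have Q2 : resolvent adj k m f x <= 2.
  pose F y := \sum_(z <- gball adj a m) heat m a z / nu z * dirac z y.
  apply: le_trans (_ : resolvent adj k m (fun y => F y + 1) x <= _).
    apply: resolvent_le => y; rewrite /f /F; case: ifPn => ay; last first.
      rewrite lerDr; apply: sumr_ge0 => z _; apply: mulr_ge0; rewrite /dirac_at//.
      have [az|az] := leqP (d a z) m; last by rewrite (heat_out G az) mul0r.
      by rewrite divr_ge0 ?(heat_ge0 G)// ltW// near.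
    by rewrite sum_dirac ?gball_uniq ?(mem_gball G)// lerDl.
  rewrite resolventD [2](_ : _ = 1 + 1)// lerD ?resolvent1_le//.
  rewrite resolvent_dirac -(sum_heat G (gball_uniq adj a m) (n := m) (x := a)).
    rewrite le_eqVlt; apply/orP; left; apply/eqP; apply: eq_big_seq => z.
    by rewrite (mem_gball G) => /near nz; rewrite divfK ?gt_eqF.
  by move=> z; rewrite (mem_gball G).
have lnQ : ln (resolvent adj k m f x) <= ln 2.
  by rewrite ler_ln ?posrE ?(resolvent_gt0 G).
by have := Hh a; lra.
Qed.

Lemma entropy_linear n x : entropy n x <= 2 * D%:R * n%:R.
Proof.
rewrite -[leRHS](iter_avg_cst G n _ x); apply: (iter_avg_le G) => z xz.
have D2 : 0 < (2 * D)%:R :> R by rewrite ltr0n muln_gt0 (maxdeg_gt0 G).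
have lb := heat_lb G xz.
have : ln ((2 * D)%:R^-1 ^+ n) <= ln (heat n x z).
  by rewrite ler_ln ?posrE ?exprn_gt0 ?invr_gt0 ?(heat_gt0 G).
rewrite exprVn lnV ?posrE ?exprn_gt0// lnXn// -(mulr_natr (ln _)).
have : ln (2 * D)%:R * n%:R <= (2 * D)%:R * n%:R :> R.
  by rewrite ler_wpM2r// ltW// ln_sublinear.
rewrite natrM.
lra.
Qed.

End Entropy.

(** * Gaussian upper bounds for the heat kernel *)

Section WeightedEnergy.
Variables (R : realType) (V : choiceType) (adj : rel V) (D : nat).
Hypothesis G : curved_graph R adj D.
Implicit Types (x y z : V) (n m k : nat) (f g : V -> R).
Local Notation d := (gdist adj).
Local Notation avg := (avg adj).
Local Notation heat := (heat R adj).
Local Notation N := (fun x => fset_set (nbhd adj x) : seq V).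

Lemma sqr_sum_le (T : Type) (s : seq T) (F : T -> R) :
  (\sum_(i <- s) F i) ^+ 2 <= (size s)%:R * \sum_(i <- s) F i ^+ 2.
Proof.
case: s => [|i0 s]; first by rewrite !big_nil expr0n mulr0.
set r := i0 :: s; set S := \sum_(i <- r) F i.
have n0 : 0 < (size r)%:R :> R by rewrite ltr0n.
have : 0 <= \sum_(i <- r) (F i - S / (size r)%:R) ^+ 2.
  by apply: sumr_ge0 => i _; exact: sqr_ge0.
have -> : \sum_(i <- r) (F i - S / (size r)%:R) ^+ 2 =
    \sum_(i <- r) F i ^+ 2 - S ^+ 2 / (size r)%:R.
  set m := S / _; rewrite (eq_bigr (fun i => F i ^+ 2 + (- (2 * m) * F i + m ^+ 2))).
    rewrite !big_split/= -mulr_sumr -/S big_const_seq count_predT iter_addr_0.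
    rewrite -[_ ^+ 2 *+ _]mulr_natl -[(size s).+1]/(size r) /m.
    by field; rewrite gt_eqF.
  by move=> i _; ring.
by rewrite subr_ge0 ler_pdivrMr// mulrC.
Qed.

Lemma sum_nbhd (s : seq V) a (F : V -> R) : uniq s ->
    (forall b, adj a b -> b \notin s -> F b = 0) ->
  \sum_(b <- N a) F b = \sum_(b <- s) (adj a b)%:R * F b.
Proof.
move=> us F0; rewrite (bigID (mem s))/= [X in _ + X]big1_seq ?addr0; last first.
  by move=> b /andP[bs]; rewrite (mem_nbhs G) => /F0 ->.
rewrite -big_filter.
under [RHS]eq_bigr do rewrite mulr_natl mulrb.
rewrite -big_mkcond/= -[RHS]big_filter; apply: perm_big.
apply: uniq_perm; rewrite ?filter_uniq ?fset_uniq// => b.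
by rewrite !mem_filter (mem_nbhs G) andbC.
Qed.

(** By laziness and Jensen's inequality, the square of the averaged function at
    [a] is at most the average, over the edges at [a], of the squared means of the
    endpoint values. Summing over [a], by reversibility, each edge carries the mean
    of its two weights, and comparing with the initial energy edge by edge costs
    only the squared relative oscillation of the weight along the edge. *)
Lemma energy_step (s : seq V) (u p : V -> R) (c : R) : uniq s ->
  (forall a b, u a != 0 -> adj a b -> b \in s) ->
  (forall b, b \notin s -> u b = 0) ->
  (forall a, 0 < p a) -> 
  (forall (a b : V), adj a b -> (p a - p b) ^+ 2 <= c * (4 * (p a * p b))) ->
  \sum_(a <- s) (deg adj a)%:R * p a * avg u a ^+ 2 <=
  (1 + c) * \sum_(a <- s) (deg adj a)%:R * p a * u a ^+ 2.
Proof.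
move=> us u1 u0 p0 pc.
have zero (a b : V) : adj a b -> b \notin s -> u a = 0.
  by move=> ab bs; apply/eqP; apply: contraNT bs => /u1 /(_ ab).
pose h (a b : V) : R := ((u a + u b) / 2) ^+ 2.
have deg0 (a : V) : 0 < (deg adj a)%:R :> R by rewrite ltr0n (deg_gt0 G).
have jensen (a : V) : (deg adj a)%:R * avg u a ^+ 2 <= \sum_(b <- N a) h a b.
  have -> : avg u a = (\sum_(b <- N a) (u a + u b) / 2) / (deg adj a)%:R.
    rewrite /avg (sum_nb G) -mulr_suml big_split/= big_const_seq count_predT.
    rewrite iter_addr_0 -[u a *+ _]mulr_natl -/(deg adj a).
    by field; rewrite gt_eqF.
  have := sqr_sum_le (N a) (fun b => (u a + u b) / 2).
  rewrite -/(deg adj a) exprMn exprVn expr2 => /(ler_wpM2l (ltW (deg0 a))) H.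
  rewrite mulrA -expr2 mulrA ler_pdivrMr ?exprn_gt0//.
  by rewrite -mulrA (le_trans H)// expr2 mulrA mulrC.
have hsum (a : V) : \sum_(b <- N a) h a b = \sum_(b <- s) (adj a b)%:R * h a b.
  apply: sum_nbhd => // b ab bs.
  by rewrite /h (zero a b)// u0// addr0 mul0r expr0n.
have degsum (a : V) : (deg adj a)%:R * u a ^+ 2 =
    \sum_(b <- s) (adj a b)%:R * u a ^+ 2.
  have [ua|ua] := eqVneq (u a) 0.
    by rewrite ua expr0n mulr0 big1// => b _; rewrite mulr0.
  rewrite -(sum_nbhd (F := fun=> u a ^+ 2))//.
    by rewrite big_const_seq count_predT iter_addr_0 -[RHS]mulr_natl.
  by move=> b ab; rewrite (u1 a b).
have pq (a b : V) : adj a b ->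
    (p a + p b) * h a b <= (1 + c) * (p a * u a ^+ 2 + p b * u b ^+ 2).
  move=> /pc; rewrite /h; move: (p0 a) (p0 b); move: (p a) (p b) (u a) (u b).
  move=> P Q A B P0 Q0 c0.
  have PQ : 0 < P * Q by rewrite mulr_gt0.
  rewrite -(ler_pM2l PQ).
  (* Cauchy--Schwarz for the weights [P] and [Q]. *)
  have h1 : P * Q * (A + B) ^+ 2 <= (P + Q) * (P * A ^+ 2 + Q * B ^+ 2).
    rewrite -subr_ge0.
    have -> : (P + Q) * (P * A ^+ 2 + Q * B ^+ 2) - P * Q * (A + B) ^+ 2 =
      (P * A - Q * B) ^+ 2 by ring.
    exact: sqr_ge0.
  have h2 : (P + Q) ^+ 2 <= 4 * (P * Q) * (1 + c) by nra.
  have E0 : 0 <= P * A ^+ 2 + Q * B ^+ 2.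
    by rewrite addr_ge0// mulr_ge0 ?sqr_ge0// ltW.
  have h3 := ler_wpM2l (ltW (addr_gt0 P0 Q0)) h1.
  have h4 := ler_wpM2r E0 h2.
  move: h3 h4; move: (P * A ^+ 2 + Q * B ^+ 2) => E.
  have -> : P * Q * ((P + Q) * ((A + B) / 2) ^+ 2) =
    ((P + Q) * (P * Q * (A + B) ^+ 2)) / 4 by field.
  by lra.
apply: le_trans (_ : \sum_(a <- s) \sum_(b <- s) (adj a b)%:R * (p a * h a b) <= _).
  apply: ler_sum => a _; have := ler_wpM2l (ltW (p0 a)) (jensen a).
  rewrite hsum mulr_sumr mulrA [p a * _]mulrC => /le_trans; apply.
  by apply: ler_sum => b _; rewrite mulrCA.
have -> : \sum_(a <- s) (deg adj a)%:R * p a * u a ^+ 2 =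
    \sum_(a <- s) \sum_(b <- s) (adj a b)%:R * (p a * u a ^+ 2).
  apply: eq_bigr => a _; rewrite mulrAC degsum mulr_suml.
  by apply: eq_bigr => b _; rewrite mulrAC mulrA.
have swap (F : V -> V -> R) : 2 * (\sum_(a <- s) \sum_(b <- s) (adj a b)%:R * F a b) =
    \sum_(a <- s) \sum_(b <- s) (adj a b)%:R * (F a b + F b a).
  have -> : \sum_(a <- s) \sum_(b <- s) (adj a b)%:R * (F a b + F b a) =
    \sum_(a <- s) \sum_(b <- s) (adj a b)%:R * F a b +
    \sum_(a <- s) \sum_(b <- s) (adj a b)%:R * F b a.
    rewrite -big_split; apply: eq_bigr => a _; rewrite -big_split.
    by apply: eq_bigr => b _; rewrite mulrDr.
  rewrite [X in _ = _ + X]exchange_big/= mulr_natl mulr2n; congr (_ + _).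
  by apply: eq_bigr => a _; apply: eq_bigr => b _; rewrite (cg_sym G).
rewrite -(ler_pM2l (ltr0Sn R 1)) mulrCA !swap mulr_sumr; apply: ler_sum => a _.
rewrite mulr_sumr; apply: ler_sum => b _.
have [ab|ab] := boolP (adj a b); last by rewrite !mul0r mulr0.
rewrite !mul1r -[h b a]/(((u b + u a) / 2) ^+ 2) [u b + _]addrC -mulrDl.
exact: pq.
Qed.

End WeightedEnergy.

Section GaussianBound.
Variables (R : realType) (V : choiceType) (adj : rel V) (D : nat).
Hypothesis G : curved_graph R adj D.
Implicit Types (x y z : V) (n m k : nat).
Local Notation d := (gdist adj).
Local Notation avg := (avg adj).
Local Notation heat := (heat R adj).

Lemma expR_le1D2x (s : R) : 0 <= s <= 2^-1 -> expR s <= 1 + 2 * s.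
Proof.
move=> /andP[s0 s1]; have := expR_ge1Dx (- s); rewrite expRN.
have e0 := expR_gt0 s; rewrite -(ler_pM2l e0) mulfV ?gt_eqF// => H.
have : expR s * (1 - s) * (1 + 2 * s) <= 1 + 2 * s.
  by rewrite ler_piMl//; lra.
have : 0 <= expR s * (s * (1 - 2 * s)).
  by rewrite mulr_ge0 ?(ltW e0)// mulr_ge0//; lra.
lra.
Qed.

Lemma exp_weight_adj (t : R) x a b : 0 <= t <= 2^-1 -> adj a b ->
  (expR (t * (d x a)%:R) - expR (t * (d x b)%:R)) ^+ 2 <=
  t ^+ 2 * (4 * (expR (t * (d x a)%:R) * expR (t * (d x b)%:R))).
Proof.
move=> t01; wlog : a b / (d x a <= d x b)%N => [hw ab|ab].
  have [|/ltnW ba] := leqP (d x a) (d x b); first by move/hw; exact.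
  rewrite -sqrrN opprB [expR (t * (d x a)%:R) * _]mulrC.
  by apply: hw => //; rewrite (cg_sym G).
move=> /gdist_adj adjab; move: (gdist_triangle G x a b) ab adjab.
move: (d x a) (d x b) (d a b) => m n k mnk mn k1.
have [e|e] : n = m \/ n = m.+1 by lia.
  by rewrite e subrr expr0n mulr_ge0 ?sqr_ge0// !mulr_ge0// expR_ge0.
rewrite e -natr1 mulrDr mulr1 expRD.
set E := expR (t * _); set s := expR t.
have s1 : s <= 1 + 2 * t by exact: expR_le1D2x.
have s2 : 1 <= s by have := expR_ge1Dx t; rewrite -/s; lra.
have -> : (E - E * s) ^+ 2 = E ^+ 2 * (s - 1) ^+ 2 by ring.
have -> : t ^+ 2 * (4 * (E * (E * s))) = E ^+ 2 * (4 * t ^+ 2 * s) by ring.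
rewrite ler_wpM2l ?sqr_ge0//.
have : 4 * t ^+ 2 <= 4 * t ^+ 2 * s by rewrite ler_peMr// mulr_ge0// sqr_ge0.
nra.
Qed.

(** The off-diagonal bound of Varopoulos and Carne, obtained by Davies' method:
    the energy of the heat kernel with the exponential weight [p] grows at most
    like [expR (t ^+ 2 * n)]. *)
Lemma heat_gaussian n x z : (0 < n)%N ->
  heat n x z ^+ 2 <= D%:R * expR (- (d x z)%:R ^+ 2 / (4 * n%:R)).
Proof.
move=> n0; have [xz|xz] := leqP (d x z) n; last first.
  by rewrite (heat_out G xz) expr0n mulr_ge0// expR_ge0.
have n0' : 0 < n%:R :> R by rewrite ltr0n.
(* This slope minimises [t ^+ 2 * n - t * r]. *)
set r : R := (d x z)%:R; pose t := r / (2 * n%:R).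
have r0 : 0 <= r by rewrite /r.
have t01 : 0 <= t <= 2^-1.
  rewrite divr_ge0 ?mulr_ge0 ?(ltW n0')//= /t invfM mulrCA ler_piMr//.
  by rewrite ler_pdivrMr// mul1r ler_nat.
pose p a := expR (t * (d x a)%:R).
pose s := gball adj x n.+1.
pose E k := \sum_(a <- s) (deg adj a)%:R * p a * heat k a x ^+ 2.
have E0 : E 0%N = (deg adj x)%:R.
  rewrite /E (bigD1_seq x) ?(mem_gball G) ?gdistxx ?gball_uniq//=.
  rewrite big1 ?addr0 => [|a /negPf ax]; last first.
    by rewrite /heat /= /dirac_at ax expr0n mulr0.
  by rewrite /heat /= /dirac_at eqxx expr1n /p gdistxx mulr0 expR0 !mulr1.
have Ek k : (k <= n)%N -> E k <= (1 + t ^+ 2) ^+ k * (deg adj x)%:R.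
  elim: k => [|k IH] kn; first by rewrite E0 expr0 mul1r.
  have t2 : 0 <= 1 + t ^+ 2 by rewrite addr_ge0 ?sqr_ge0.
  rewrite exprS -mulrA; apply: le_trans (ler_wpM2l t2 (IH (ltnW kn))).
  apply: (energy_step G) => //.
  - exact: gball_uniq.
  - move=> a b ua ab; rewrite (mem_gball G).
    have : (d x a <= k)%N.
      by rewrite leqNgt; apply: contra ua => xa; apply/eqP/(heat_out G); rewrite (gdistC G).
    have := gdist_triangle G x a b; have := gdist_adj ab.
    by move: (d x b) (d a b) (d x a) kn; clear; lia.
  - move=> b; rewrite (mem_gball G) -ltnNge => nb.
    apply: (heat_out G); rewrite (gdistC G); apply: ltn_trans nb.
    by apply: ltn_trans kn _.
  - by move=> a; exact: expR_gt0.
  - by move=> a b ab; exact: exp_weight_adj.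
have En : (deg adj z)%:R * p z * heat n z x ^+ 2 <=
    expR (t ^+ 2 * n%:R) * (deg adj x)%:R.
  apply: le_trans (_ : E n <= _).
    rewrite /E (bigD1_seq z) ?(mem_gball G) ?gball_uniq//=; last exact: leq_trans xz _.
    rewrite lerDl; apply: sumr_ge0 => a _.
    by rewrite mulr_ge0 ?sqr_ge0// mulr_ge0// expR_ge0.
  apply: le_trans (Ek n (leqnn n)) _; rewrite ler_wpM2r// mulrC expRM_natl.
  by rewrite lerXn2r ?nnegrE ?addr_ge0 ?sqr_ge0 ?expR_ge0// expR_ge1Dx.
have dx : 0 < (deg adj x)%:R :> R by rewrite ltr0n (deg_gt0 G).
have dz : 0 < (deg adj z)%:R :> R by rewrite ltr0n (deg_gt0 G).
have -> : expR (- r ^+ 2 / (4 * n%:R)) = expR (t ^+ 2 * n%:R) / expR (t * r).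
  by rewrite -expRB; congr expR; rewrite /t; field; rewrite gt_eqF.
rewrite mulrA ler_pdivlMr ?expR_gt0//.
have rev : heat n z x = (deg adj x)%:R / (deg adj z)%:R * heat n x z.
  by rewrite mulrAC (heat_rev G) mulrC mulKf// gt_eqF.
have H : (deg adj x)%:R * (heat n x z ^+ 2 * p z) <=
   (deg adj z)%:R * expR (t ^+ 2 * n%:R).
  rewrite -(ler_pM2l dx) [leRHS]mulrCA.
  have -> : (deg adj x)%:R * ((deg adj x)%:R * (heat n x z ^+ 2 * p z)) =
     (deg adj z)%:R * ((deg adj z)%:R * p z * heat n z x ^+ 2).
    by rewrite rev; field; rewrite gt_eqF.
  by rewrite ler_pM2l// [leRHS]mulrC.
have pz0 : 0 <= heat n x z ^+ 2 * p z by rewrite mulr_ge0 ?sqr_ge0// expR_ge0.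
apply: le_trans (_ : (deg adj x)%:R * (heat n x z ^+ 2 * p z) <= _).
  by rewrite ler_peMl// ler1n (deg_gt0 G).
by apply: le_trans H _; rewrite ler_wpM2r ?expR_ge0// ler_nat (cg_deg G).
Qed.

(** Moving far is only possible if the law is spread out: where the walk is at
    distance [r], the heat kernel is at most of order [expR (- r ^+ 2 / (8 n))]. *)
Theorem second_moment_le n x : (0 < n)%N ->
  iter n avg (fun z => (d x z)%:R ^+ 2) x <= 8 * n%:R * (entropy R adj n x + D%:R) :> R.
Proof.
move=> n0; have n0' : 0 < n%:R :> R by rewrite ltr0n.
have D0 : 0 < D%:R :> R by rewrite ltr0n (maxdeg_gt0 G).
have -> : 8 * n%:R * (entropy R adj n x + D%:R) =
    iter n avg (fun z => 8 * n%:R * (- ln (heat n x z) + D%:R)) x.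
  by rewrite iter_avgZ iter_avgDl (iter_avg_cst G).
apply: (iter_avg_le G) => z xz.
have p0 := heat_gt0 G xz.
have := heat_gaussian x z n0; rewrite -ler_ln ?posrE ?exprn_gt0 ?mulr_gt0 ?expR_gt0//.
rewrite lnXn// lnM ?posrE ?expR_gt0// expRK mulr2n.
set r := _ ^+ 2; set q := - r / _.
have -> : r = - q * (4 * n%:R) by rewrite /q; field; rewrite gt_eqF.
have := ln_sublinear D0; move: (ln D%:R) (ln (heat n x z)) => b a bD ab.
have H : - q <= 2 * (- a + D%:R) by lra.
have -> : 8 * n%:R * (- a + D%:R) = 2 * (- a + D%:R) * (4 * n%:R) by ring.
by rewrite ler_wpM2r// mulr_ge0// ltW.
Qed.

End GaussianBound.

(** * Bootstrapping the entropy *)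

Section EntropyGrowth.
Variables (R : realType) (V : choiceType) (adj : rel V) (D : nat).
Hypothesis G : curved_graph R adj D.
Implicit Types (x y z : V) (n m k : nat) (b : R).
Local Notation d := (gdist adj).
Local Notation avg := (avg adj).

Lemma ratio_le_lnB (q t : R) : 0 < q -> 0 < t -> (t - q) / t <= ln t - ln q.
Proof.
move=> q0 t0; have := ln_le_sub1 (divr_gt0 q0 t0).
rewrite ln_div ?posrE// mulrBl divff ?gt_eqF//; lra.
Qed.

Lemma harmonic_le_ln m : (0 < m)%N ->
  \sum_(i < m) i.+1%:R^-1 <= 1 + ln m%:R :> R.
Proof.
case: m => // m _; elim: m => [|m IH].
  by rewrite big_ord1 ln1 addr0 invr1.
rewrite big_ord_recr/=.
have := @ratio_le_lnB m.+1%:R m.+2%:R (ltr0Sn _ _) (ltr0Sn _ _).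
have -> : (m.+2%:R - m.+1%:R) / m.+2%:R = m.+2%:R^-1 :> R.
  by rewrite -[X in (X - _) / _](natr1 m.+1) [_ + 1]addrC addrK div1r.
by move=> /(lerD IH)/le_trans; apply; rewrite -addrA subrKC.
Qed.

Definition entropy_bounded T b : Prop :=
  forall n x, (n <= T)%N -> entropy R adj n x <= b.

(** The Harnack cost of the displacement made in [s] steps, with [q] steps to go:
    the squared displacement is itself controlled by the entropy at time [s]. *)
Lemma avg_cost_le s q n x b : (0 < s)%N -> (0 < q)%N -> (q <= n)%N -> 1 <= b ->
  entropy R adj s x <= b ->
  iter s avg (fun a => harnack_cost D q (d x a)%:R) x + ln 2 <=
    256 * D%:R * (1 + D%:R) * b * (s%:R / q%:R) +
    131 * D%:R * (1 + ln n%:R).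
Proof.
move=> s0 q0 qn b1 Hb.
have D1 : 1 <= D%:R :> R by rewrite ler1n (maxdeg_gt0 G).
have q0' : 0 < q%:R :> R by rewrite ltr0n.
have n0' : 0 < n%:R :> R by rewrite ltr0n (leq_trans q0).
have lnn : 0 <= ln n%:R :> R by rewrite ln_ge0// ler1n (leq_trans q0).
have ln21 : ln 2 <= 1 :> R by have := @ln_le_sub1 R 2 (ltr0Sn _ _); lra.
have Hq : \sum_(i < q) i.+1%:R^-1 <= 1 + ln n%:R :> R.
  apply: le_trans (harmonic_le_ln q0) _.
  by rewrite lerD2l ler_ln ?posrE// ler_nat.
pose c : R := 128 * D%:R * (1 + ln n%:R) + (ln 2 + D%:R / 2).
apply: le_trans (_ : iter s avg
    (fun a => 32 * D%:R / q%:R * (d x a)%:R ^+ 2 + c) x + ln 2 <= _).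
  rewrite lerD2r; apply: (iter_avg_le G) => a _.
  rewrite /harnack_cost -addrA; apply: lerD.
    have -> : 32 * D%:R / q%:R * (d x a)%:R ^+ 2 =
      4 * D%:R * ((d x a)%:R ^+ 2 / (q%:R / 8)) :> R by field; rewrite gt_eqF.
    rewrite ler_wpM2l ?mulr_ge0// /huber ler_wpM2l ?sqr_ge0//.
    rewrite lef_pV2 ?posrE ?divr_gt0 ?ltr_wpDr ?divr_gt0//.
    by rewrite -[leLHS]addr0 lerD// ler_pM2r// ler_nat.
  by rewrite lerD2r ler_wpM2l// mulr_ge0.
rewrite iter_avgDl iter_avgZ (iter_avg_cst G).
have := second_moment_le G x s0; set S := iter s avg _ x => HS.
have : 32 * D%:R / q%:R * S <= 32 * D%:R / q%:R * (8 * s%:R * (b + D%:R)).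
  rewrite ler_wpM2l ?divr_ge0 ?mulr_ge0// ?(ltW q0')//.
  by apply: le_trans HS _; rewrite ler_wpM2l ?mulr_ge0// lerD2r.
have -> : 32 * D%:R / q%:R * (8 * s%:R * (b + D%:R)) =
  256 * D%:R * (s%:R / q%:R) * (b + D%:R) by field; rewrite gt_eqF.
have : 256 * D%:R * (s%:R / q%:R) * (b + D%:R) <=
  256 * D%:R * (s%:R / q%:R) * ((1 + D%:R) * b).
  rewrite ler_wpM2l ?mulr_ge0 ?divr_ge0// ?(ltW q0')//.
  by rewrite mulrDl mul1r lerD2l ler_peMr.
have -> : 256 * D%:R * (1 + D%:R) * b * (s%:R / q%:R) =
  256 * D%:R * (s%:R / q%:R) * ((1 + D%:R) * b) by ring.
have : 3 * D%:R <= 3 * D%:R * (1 + ln n%:R) :> R by rewrite ler_peMr ?mulr_ge0// lerDl.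
by rewrite /c; lra.
Qed.

Definition growth_const : R := 1 + 512 * D%:R * (1 + D%:R) + 131 * D%:R.

(** Prepending blocks of [T] steps, a block with [q] steps to go adds
    [b * T / q], up to constants, plus a logarithm. The first contributions sum to
    [b] times a logarithm, the second ones to [N / T] logarithms: the entropy bound
    [b] and the number [m] of blocks are added, not multiplied. *)
Theorem entropy_growth T b m N n : (0 < T)%N -> 1 <= b -> entropy_bounded T b ->
  (N <= m * T)%N -> (N <= n)%N ->
  entropy_bounded N (growth_const * (1 + ln n%:R) * (b + m%:R)).
Proof.
move=> T0 b1 HT NmT Nn.
have D1 : 1 <= D%:R :> R by rewrite ler1n (maxdeg_gt0 G).
have T0' : 0 < T%:R :> R by rewrite ltr0n.
pose A : R := 512 * D%:R * (1 + D%:R) * b.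
pose B : R := 131 * D%:R * (1 + ln n%:R).
have b0 : 0 <= b by exact: le_trans ler01 b1.
have A0 : 0 <= A.
  exact: (mulr_ge0 (mulr_ge0 (mulr_ge0 (ler0n R 512) (ler0n R D))
    (addr_ge0 ler01 (ler0n R D))) b0).
(* One block; [s / q] is compared with the increment of the logarithm. *)
have step s q x h : (0 < s)%N -> (s <= q)%N -> (s <= T)%N -> (s + q <= n)%N ->
    (forall a, entropy R adj q a <= h) ->
    entropy R adj (s + q) x <= h + A * (ln (s + q)%:R - ln q%:R) + B.
  move=> s0 sq sT sqn Hh.
  have q0 : (0 < q)%N by exact: leq_trans sq.
  have qn : (q <= n)%N by apply: leq_trans sqn; rewrite leq_addl.
  apply: le_trans (entropy_step G s x Hh) _; rewrite -!addrA lerD2l.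
  apply: le_trans (avg_cost_le s0 q0 qn b1 (HT s x sT)) _.
  rewrite lerD2r /A -!mulrA.
  have q0' : 0 < q%:R :> R by rewrite ltr0n.
  have t0' : 0 < (s + q)%:R :> R by rewrite ltr0n addn_gt0 q0 orbT.
  have := ratio_le_lnB q0' t0'; rewrite {1}natrD addrK.
  have sq2 : s%:R / q%:R <= 2 * (s%:R / (s + q)%:R) :> R.
    rewrite mulrCA ler_wpM2l// ler_pdivlMr// mulrC ler_pdivrMr// -natrM ler_nat.
    by rewrite mul2n -addnn leq_add2r.
  move=> H; have -> : 512 * (D%:R * ((1 + D%:R) * (b * (ln (s + q)%:R - ln q%:R)))) =
    256 * (D%:R * ((1 + D%:R) * (b * (2 * (ln (s + q)%:R - ln q%:R))))) :> R by ring.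
  rewrite ler_wpM2l// ler_wpM2l// ler_wpM2l ?addr_ge0// ler_wpM2l//.
  by apply: le_trans sq2 _; rewrite ler_wpM2l.
have lnge0 t : (0 < t)%N -> (t <= n)%N -> 0 <= ln t%:R :> R.
  by move=> t0 tn; rewrite ln_ge0// ler1n.
have claim t x : (T <= t)%N -> (t <= n)%N ->
    entropy R adj t x <= b + A * (ln t%:R - ln T%:R) + B * (t%:R / T%:R).
  elim/ltn_ind: t x => t IH x Tt tn.
  have t0 : (0 < t)%N by exact: leq_trans Tt.
  have B0 : 0 <= B.
    rewrite /B; have := lnge0 n (leq_trans t0 tn) (leqnn n) => ?.
    by rewrite !mulr_ge0// addr_ge0.
  have tT1 : 1 <= t%:R / T%:R :> R by rewrite ler_pdivlMr// mul1r ler_nat.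
  have lnT : ln T%:R <= ln t%:R :> R by rewrite ler_ln ?posrE ?ltr0n// ler_nat.
  have BtT : B <= B * (t%:R / T%:R) by rewrite ler_peMr.
  have [tT|tT] := leqP t T.
    have := HT t x tT.
    have : 0 <= A * (ln t%:R - ln T%:R) by rewrite mulr_ge0// subr_ge0.
    lra.
  have [t2|t2] := leqP (T + T) t.
    have e : t = (T + (t - T))%N by rewrite subnKC.
    have qt : (t - T < t)%N by rewrite ltn_subrL T0 t0.
    have := step T (t - T)%N x
      (b + A * (ln (t - T)%:R - ln T%:R) + B * ((t - T)%:R / T%:R)).
    rewrite -e => /(_ T0 _ (leqnn T) tn) H.
    apply: le_trans (H _ _) _.
    - by rewrite leq_subRL.
    - by move=> a; apply: IH => //; rewrite ?leq_subRL// (leq_trans _ tn)// ltnW.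
    have -> : (t - T)%:R = t%:R - T%:R :> R by rewrite natrB// ltnW.
    have -> : (t%:R - T%:R) / T%:R = t%:R / T%:R - 1 :> R.
      by rewrite mulrBl divff ?gt_eqF.
    by lra.
  have e : t = ((t - T) + T)%N by rewrite subnK// ltnW.
  have := step (t - T)%N T x b; rewrite -e subn_gt0 tT => /(_ isT) H.
  have tTT : (t - T <= T)%N by rewrite leq_subLR ltnW.
  have := H tTT tTT tn (fun a => HT T a (leqnn T)); lra.
move=> t x tN.
have gc : 1 <= growth_const.
  have : 0 <= D%:R * (1 + D%:R) :> R by rewrite mulr_ge0// addr_ge0.
  by rewrite /growth_const -mulrA; lra.
have [->|t0] := posnP t.
  have := HT 0%N x (leq0n T).
  have : b <= growth_const * (1 + ln n%:R) * (b + m%:R).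
    have n1 : 0 <= ln n%:R :> R.
      have [->|n0] := posnP n; first by rewrite ln0.
      by rewrite ln_ge0// ler1n.
    have m0 : 0 <= m%:R :> R by [].
    have : 1 <= growth_const * (1 + ln n%:R) by rewrite mulr_ege1// lerDl.
    nra.
  lra.
have tn := leq_trans tN Nn.
have lnn := lnge0 n (leq_trans t0 tn) (leqnn n).
have m0 : 0 <= m%:R :> R by [].
have gc1 : b <= growth_const * (1 + ln n%:R) * (b + m%:R).
  have : 1 <= growth_const * (1 + ln n%:R) by rewrite mulr_ege1// lerDl.
  nra.
have [tT|tT] := leqP t T; first exact: le_trans (HT t x tT) _.
apply: le_trans (claim t x (ltnW tT) tn) _.
have B0 : 0 <= B by rewrite /B !mulr_ge0// addr_ge0.
have lnT : 0 <= ln T%:R :> R by rewrite ln_ge0// ler1n.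
have lnt : ln t%:R <= ln n%:R :> R by rewrite ler_ln ?posrE ?ltr0n// ?ler_nat// (leq_trans t0).
have H1 : A * (ln t%:R - ln T%:R) <= A * (1 + ln n%:R) by rewrite ler_wpM2l//; lra.
have H2 : B * (t%:R / T%:R) <= B * m%:R.
  by rewrite ler_wpM2l// ler_pdivrMr// -natrM ler_nat (leq_trans tN).
have L1 : 1 <= 1 + ln n%:R :> R by rewrite lerDl.
move: H1 H2; rewrite /A /B /growth_const; move: (1 + ln n%:R) L1 => L L1 H1 H2.
have E0 : 0 <= D%:R * (1 + D%:R) :> R by rewrite mulr_ge0// addr_ge0.
have P1 : b <= L * b by rewrite ler_peMl//; lra.
have P2 : 0 <= L * m%:R by rewrite mulr_ge0//; lra.
have P3 : 0 <= D%:R * (1 + D%:R) * (L * m%:R) by rewrite mulr_ge0.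
have P4 : 0 <= D%:R * (L * b) by rewrite !mulr_ge0//; lra.
lra.
Qed.

End EntropyGrowth.

(** * Choice of the number of scales *)

Section Optimisation.
Variables (R : realType) (V : choiceType) (adj : rel V) (D : nat).
Hypothesis G : curved_graph R adj D.
Implicit Types (x y z : V) (n m k : nat) (b : R).
Local Notation d := (gdist adj).
Local Notation avg := (avg adj).

Lemma growth_const_ge1 : 1 <= growth_const R D.
Proof.
have : 0 <= D%:R * (1 + D%:R) :> R by rewrite mulr_ge0// addr_ge0.
have : 0 <= D%:R :> R by [].
by rewrite /growth_const -mulrA; lra.
Qed.

(** Multiplying the time horizon by [m] costs only a logarithmic factor in the
    entropy once the entropy has reached [m]; hence reaching [n <= m ^ k.+1]
    from the trivial linear bound at time [m] costs [m] times [k] logarithms. *)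
Lemma entropy_iter n m k x : (0 < n)%N -> (0 < m)%N -> (n <= m ^ k.+1)%N ->
  entropy R adj n x <=
    2 * D%:R * m%:R * (2 * growth_const R D * (1 + ln n%:R)) ^+ k.
Proof.
move=> n0 m0 nm; set c := 2 * growth_const R D * _.
have D1 : 1 <= D%:R :> R by rewrite ler1n (maxdeg_gt0 G).
have m1 : 1 <= m%:R :> R by rewrite ler1n.
have lnn : 0 <= ln n%:R :> R by rewrite ln_ge0// ler1n.
have gl : 1 <= growth_const R D * (1 + ln n%:R).
  by rewrite mulr_ege1 ?growth_const_ge1// lerDl.
have c1 : 1 <= c by rewrite /c -mulrA; lra.
suff H j : entropy_bounded (R := R) adj (minn (m ^ j.+1) n) (2 * D%:R * m%:R * c ^+ j).
  by have := H k; rewrite (minn_idPr nm); exact.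
elim: j => [|j IH].
  rewrite expr0 mulr1 expn1 => t y /leq_trans/(_ (geq_minl _ _)) tm.
  apply: le_trans (entropy_linear G t y) _.
  by rewrite ler_wpM2l ?mulr_ge0// ler_nat.
set b := 2 * D%:R * m%:R * c ^+ j in IH *.
have bm : m%:R <= b.
  have D2 : 1 <= 2 * D%:R :> R by lra.
  rewrite /b mulrAC ler_peMl ?(le_trans ler01 m1)//.
  by rewrite mulr_ege1 ?exprn_ege1.
have T0 : (0 < minn (m ^ j.+1) n)%N by rewrite leq_min expn_gt0 m0 n0.
have NT : (minn (m ^ j.+2) n <= m * minn (m ^ j.+1) n)%N.
  rewrite minnMr -expnS leq_min geq_minl/= (leq_trans (geq_minr _ _))//.
  by rewrite leq_pmull.
move=> t y tN.
have H := entropy_growth G T0 (le_trans m1 bm) IH NT (geq_minr _ _).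
apply: le_trans (H t y tN) _.
rewrite exprSr mulrA -/b /c.
rewrite [leLHS](_ : _ = growth_const R D * (1 + ln n%:R) * (b + m%:R)); last by ring.
rewrite [leRHS](_ : _ = growth_const R D * (1 + ln n%:R) * (b + b)); last by ring.
by rewrite ler_wpM2l ?lerD2l// (le_trans ler01 gl).
Qed.

Definition diffusivity_const : R :=
  2 + ln (4 * growth_const R D) + ln (40 * D%:R).

(** Reaching time [n] in [k.+1] scales of ratio [m] costs [m], at least the
    [k.+1]-th root of [n], times [k] logarithms of [n]. With [L = ln n] and
    [l = ln L], both have logarithm of order [q = sqrt (L * l)] when [k] is about
    [L / q = sqrt (L / l)]. *)
Theorem second_moment_quasilinear n x : expR (expR 1) <= n%:R :> R ->
  iter n avg (fun z => (d x z)%:R ^+ 2) x <=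
    n%:R * expR (diffusivity_const * Num.sqrt (ln n%:R * ln (ln n%:R))).
Proof.
move=> ne; set L := ln n%:R; set l := ln L; set q := Num.sqrt (L * l).
have n0' : 0 < n%:R :> R by rewrite (lt_le_trans _ ne)// expR_gt0.
have n0 : (0 < n)%N by rewrite -(ltr0n R).
have Le : expR 1 <= L by rewrite -ler_expR lnK.
have L2 : 2 <= L by apply: le_trans Le; have := expR_ge1Dx (1 : R); lra.
have L0 : 0 < L by lra.
have l1 : 1 <= l by rewrite -ler_expR lnK.
have Ll1 : 1 <= L * l by rewrite mulr_ege1//; lra.
have q1 : 1 <= q by rewrite -sqrtr1 ler_wsqrtr.
have q0 : 0 < q by lra.
have qq : q ^+ 2 = L * l by rewrite sqr_sqrtr//; lra.
have Lq : L / q <= q.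
  by rewrite ler_pdivrMr// -expr2 qq ler_peMr// ltW.
have Lq0 : 0 <= L / q by rewrite divr_ge0 ?ltW.
pose k := Num.truncn (L / q); pose m := (Num.truncn (expR q)).+1.
have /andP[kL kL'] : k%:R <= L / q < k.+1%:R by exact: truncn_itv.
have /andP[mq mq'] : (Num.truncn (expR q))%:R <= expR q < m%:R.
  by apply: truncn_itv; exact: expR_ge0.
have nm : (n <= m ^ k.+1)%N.
  rewrite -(ler_nat R) natrX -[leLHS]lnK// -/L.
  apply: le_trans (_ : expR q ^+ k.+1 <= _).
    rewrite -expRM_natl ler_expR; move: kL'; rewrite ltr_pdivrMr// => /ltW.
    exact.
  by rewrite lerXn2r ?nnegrE ?expR_ge0// ltW.
have m0 : (0 < m)%N by [].
have := entropy_iter x n0 m0 nm; rewrite -/L.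
set c := growth_const R D; have c1 : 1 <= c by exact: growth_const_ge1.
have c4 : 0 < 4 * c by lra.
have pow : (2 * c * (1 + L)) ^+ k <= expR (q * (1 + ln (4 * c))).
  apply: le_trans (_ : (4 * c * L) ^+ k <= _).
    rewrite lerXn2r ?nnegrE ?mulr_ge0//; try lra.
    by rewrite -subr_ge0 (_ : _ - _ = 2 * c * (L - 1)); [rewrite !mulr_ge0//; lra|ring].
  have -> : 4 * c * L = expR (ln (4 * c) + l).
    by rewrite expRD !lnK.
  rewrite -expRM_natl ler_expR.
  have h1 : k%:R * l <= q.
    apply: le_trans (_ : L / q * l <= _); first by rewrite ler_wpM2r//; lra.
    by rewrite mulrAC -qq expr2 mulfK ?gt_eqF.
  have h2 : k%:R * ln (4 * c) <= q * ln (4 * c).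
    by rewrite ler_wpM2r ?(le_trans kL)// ln_ge0//; lra.
  by lra.
move=> Hent.
have D1 : 1 <= D%:R :> R by rewrite ler1n (maxdeg_gt0 G).
have e1 : 1 <= expR q by rewrite -[leLHS]expR0 ler_expR ltW.
have m2 : m%:R <= 2 * expR q.
  have -> : m%:R = (Num.truncn (expR q))%:R + 1 :> R by rewrite natr1.
  by rewrite mulrDl mul1r lerD.
move: (m) (k) m2 pow Hent => {m k m0 mq mq' kL kL' nm} m k m2 pow Hent.
set E := expR (q * (1 + ln (4 * c))) in pow.
have E1 : 1 <= E.
  have l4 : 0 <= ln (4 * c) by rewrite ln_ge0//; lra.
  suff : expR 0 <= E by rewrite expR0.
  by rewrite ler_expR mulr_ge0 ?(ltW q0)// addr_ge0.
apply: le_trans (second_moment_le G x n0) _.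
rewrite [8 * _]mulrC -mulrA ler_wpM2l//.
have H1 : entropy R adj n x <= 4 * D%:R * (expR q * E).
  apply: le_trans Hent _.
  have -> : 4 * D%:R * (expR q * E) = 2 * D%:R * (2 * expR q) * E by ring.
  have cL : 0 <= 2 * c * (1 + L) by rewrite !mulr_ge0//; lra.
  apply: ler_pM => //.
  - exact: exprn_ge0.
  - by apply: ler_wpM2l => //; exact: mulr_ge0.
have qE : 1 <= expR q * E by rewrite mulr_ege1.
have H2 : D%:R <= D%:R * (expR q * E) by rewrite ler_peMr.
apply: le_trans (_ : 40 * D%:R * (expR q * E) <= _).
  have -> : 40 * D%:R * (expR q * E) =
    8 * (4 * D%:R * (expR q * E) + D%:R * (expR q * E)) by ring.
  by rewrite ler_wpM2l// lerD.
have D40 : 0 < 40 * D%:R :> R by lra.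
rewrite -[40 * D%:R]lnK// -!expRD ler_expR /diffusivity_const -/c.
have : ln (40 * D%:R) <= ln (40 * D%:R) * q :> R.
  by rewrite ler_peMr// ln_ge0//; lra.
lra.
Qed.

End Optimisation.

(** * From the Markov chain to the averaging operator *)

Section MarkovChain.
Variables (R : realType) (V : choiceType) (adj : rel V) (D : nat).
Hypothesis G : curved_graph R adj D.
Local Notation d := (gdist adj).
Local Notation avg := (avg adj).
Local Notation K := (lazy_kernel R adj).
Local Notation nb := (nb adj).

(** The pieces [B i] need only cover [A] up to a null set. *)
Lemma integral_partition (disp : measure_display) (T : measurableType disp)
    (P : probability T R) (A : set T) (I : eqType) (s : seq I) (B : I -> set T)
    (g : T -> \bar R) :
  measurable A -> (forall i, measurable (B i)) -> uniq s ->
  trivIset [set` s] B -> (forall i, B i `<=` A) ->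
  P A = (\sum_(i <- s) P (B i))%E ->
  measurable_fun [set: T] g -> (forall w, (0 <= g w)%E) ->
  (\int[P]_(w in A) g w = \sum_(i <- s) \int[P]_(w in B i) g w)%E.
Proof.
move=> mA mB us tB BA PA mg g0.
pose U := \big[setU/set0]_(i <- s) B i.
have mU : measurable U by exact: bigsetU_measurable.
have UA : U `<=` A.
  by rewrite /U; elim/big_ind : _ => // X Y XA YA w [/XA|/YA].
have mgU E : measurable E -> measurable_fun E g.
  by move=> mE; apply: measurable_funS mg.
have PU : P U = P A.
  rewrite PA; have := @ge0_integral_bigsetU _ _ _ P I B (cst 1%E) s mB us tB.
  move=> /(_ (measurable_cst _) (fun _ _ => lee01)).
  rewrite integral_cst// mul1e => ->; apply: eq_bigr => i _.
  by rewrite integral_cst// mul1e.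
have PN : P (A `\` U) = 0%E.
  rewrite measureD ?(le_lt_trans (probability_le1 _ _)) ?ltry//.
  have -> : A `&` U = U by apply/setIidPr.
  have fA : P A \is a fin_num by exact: fin_num_measure.
  by have : (P A - P U = 0)%E by rewrite PU subee.
rewrite -(setDUK UA) ge0_integral_setU//.
- rewrite (null_set_integral (N := A `\` U))// ?adde0; last 2 first.
  + exact: measurableD.
  + exact/mgU/measurableD.
  rewrite ge0_integral_bigsetU//; exact: mgU.
- exact: measurableD.
- by apply: mgU; apply: measurableU => //; exact: measurableD.
- by apply/disj_setPS => w [Uw [_]].
Qed.

Variables (x : V) (disp : measure_display) (Omega : measurableType disp).
Variables (P : probability Omega R) (X : nat -> Omega -> V).
Hypothesis MC : markov_chain K x P X.

Let cyl n (s : nat -> V) : set Omega := [set w | forall i, (i <= n)%N -> X i w = s i].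

Let mX n (g : V -> \bar R) : measurable_fun [set: Omega] (fun w => g (X n w)).
Proof.
move=> _ B mB; rewrite setTI; case: MC => H _ _.
exact: (H n (g @^-1` B)).
Qed.

Let mcyl n s : measurable (cyl n s).
Proof.
case: MC => H _ _; have -> : cyl n s = \bigcap_(i in [set i | (i <= n)%N])
   (X i @^-1` [set s i]) by apply/seteqP; split.
by apply: bigcap_measurableType => i _; exact: H.
Qed.

Let upd n (s : nat -> V) v : nat -> V := fun i => if i == n.+1 then v else s i.

Let cyl_upd n s v : cyl n.+1 (upd n s v) = cyl n s `&` (X n.+1 @^-1` [set v]).
Proof.
apply/seteqP; split => w /=.
  move=> H; split; last by have := H n.+1 (leqnn _); rewrite /upd eqxx.
  by move=> i ni; rewrite (H i (leqW ni)) /upd ltn_eqF.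
case=> H Hv i; rewrite leq_eqVlt ltnS /upd => /predU1P[->|ni].
  by rewrite eqxx.
by rewrite H// ltn_eqF.
Qed.

(** The Markov property, summed over the next position; the paths that leave the
    support of the kernel form a null set. *)
Let integral_cyl n k s (f : V -> R) : (forall z, 0 <= f z) ->
  (\int[P]_(w in cyl n s) (f (X (n + k)%N w))%:E =
   P (cyl n s) * (iter k avg f (s n))%:E)%E.
Proof.
move=> f0; elim: k n s => [|k IH] n s.
  rewrite addn0 -[RHS]muleC -integral_cst//; apply: eq_integral => w.
  by move=> /set_mem /(_ n (leqnn n)) ->.
have step v : P (cyl n.+1 (upd n s v)) = (P (cyl n s) * (K (s n) v)%:E)%E.
  case: MC => _ _ H; rewrite H /upd eqxx (ltn_eqF (ltnSn n)); congr (P _ * _)%E.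
  apply/seteqP; split => w /= Hw i ni; rewrite Hw//.
  - by rewrite ltn_eqF.
  - by rewrite ltn_eqF.
have fin : P (cyl n s) \is a fin_num by exact: fin_num_measure.
rewrite (@integral_partition _ _ P _ V (nb (s n)) (fun v => cyl n.+1 (upd n s v))).
- under eq_bigr do rewrite addnS -addSn IH step -muleA.
  rewrite -ge0_sume_distrr; last first.
    move=> v _; rewrite -EFinM lee_fin mulr_ge0 ?kernel_ge0//.
    exact: (iter_avg_ge0 G).
  congr (_ * _)%E; rewrite sumEFin; congr EFin; rewrite /= /avg.
  by apply: eq_bigr => v _; rewrite /upd eqxx.
- exact: mcyl.
- by move=> v; exact: mcyl.
- exact: (nb_uniq G).
- move=> u v _ _ [w []]; rewrite !cyl_upd => -[_ /= <-] [_ /= <-].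
  by [].
- by move=> v; rewrite cyl_upd => w [].
- under eq_bigr do rewrite step.
  rewrite -ge0_sume_distrr => [|v _]; last by rewrite lee_fin kernel_ge0.
  by rewrite sumEFin (sum_kernel G) mule1.
- exact: (mX (n + k.+1) (fun v => (f v)%:E)).
- by move=> w; rewrite lee_fin.
Qed.

Theorem expectation_markov n (f : V -> R) : (forall z, 0 <= f z) ->
  ('E_P[fun w => f (X n w)] = (iter n avg f x)%:E)%E.
Proof.
move=> f0; rewrite unlock.
have cyl0 : cyl 0 (fun=> x) = [set w | X 0%N w = x].
  apply/seteqP; split => w /= H; first exact: H.
  by move=> i; rewrite leqn0 => /eqP ->.
have P1 : P (cyl 0 (fun=> x)) = 1%E by rewrite cyl0; case: MC.
rewrite (@integral_partition _ _ P _ unit [:: tt] (fun=> cyl 0 (fun=> x))) //.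
- by rewrite big_seq1 (@integral_cyl 0 n _ f f0) P1 mul1e.
- by move=> [] [].
- by rewrite big_seq1 P1 probability_setT.
- exact: (mX n (fun v => (f v)%:E)).
- by move=> w; rewrite lee_fin.
Qed.

End MarkovChain.

Theorem corollary2p2 (R : realType) (d : nat) :
  exists C : R,
    forall (V : choiceType) (adj : rel V),
      symmetric adj -> irreflexive adj ->
      (exists x y, adj x y) ->
      graph_connected adj ->
      locally_finite adj ->
      (forall x, (deg adj x <= d)%N) ->
      nonneg_Ollivier_Ricci R adj ->
      forall (x : V) (disp : measure_display) (Omega : measurableType disp)
             (P : probability Omega R) (X : nat -> Omega -> V),
        markov_chain (lazy_kernel R adj) x P X ->
        forall n : nat, expR (expR 1) <= n%:R :> R ->
          ('E_P[fun w => ((gdist adj x (X n w))%:R ^+ 2)%R] <=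
           (n%:R * expR (C * Num.sqrt (ln n%:R * ln (ln n%:R))))%:E)%E.
Proof.
exists (diffusivity_const R d) => V adj sym irr edge conn fin degd curv.
have G : curved_graph R adj d by [].
move=> x disp Omega P X MC n ne.
rewrite (expectation_markov G MC n (f := fun z => (gdist adj x z)%:R ^+ 2)).
  by rewrite lee_fin; exact: (second_moment_quasilinear G).
by move=> z; rewrite exprn_ge0.
Qed.
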